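(* Let $R$ be a unital associative ring and $M$ a left $R$-module. (i) If $\mathrm{pd}_R M < \infty$, then $\mathrm{PGF\text{-}dim}_R M = \mathrm{pd}_R M$. (ii) If $\mathrm{PGF\text{-}dim}_R M < \infty$, then $\mathrm{Gpd}_R M = \mathrm{PGF\text{-}dim}_R M$.
   Context: $R$ is a unital associative ring; modules are left $R$-modules; $\mathrm{pd}_R$ is projective dimension. A PGF-module (projectively coresolved Gorenstein flat module) is a syzygy (i.e. a kernel of some differential) of an acyclic ($\mathbb{Z}$-indexed) complex $P_*$ of projective modules such that the complex $I \otimes_R P_*$ is acyclic for every injective right $R$-module $I$; $\mathtt{PGF}(R)$ is the class of PGF-modules. For a module $M$, $\mathrm{PGF\text{-}dim}_R M$ is the least non-negative integer $n$ for which there is an exact sequence $0 \to G_n \to \cdots \to G_0 \to M \to 0$ with all $G_i \in \mathtt{PGF}(R)$, and $\mathrm{PGF\text{-}dim}_R M = \infty$ if no such $n$ exists. A Gorenstein projective module is a syzygy of an acyclic complex $P_*$ of projective modules such that $\mathrm{Hom}_R(P_*,Q)$ is acyclic for every projective module $Q$; the Gorenstein projective dimension $\mathrm{Gpd}_R M$ is the least length of a resolution of $M$ by Gorenstein projective modules ($\infty$ if there is none of finite length). *)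

(* Defs.v *)
From HB Require Import structures.
From mathcomp Require Import all_boot all_algebra.
From mathcomp Require Import generic_quotient ring_quotient.
From mathcomp Require Import boolp.
From mathcomp Require Import freeg.

Set Implicit Arguments.
Unset Strict Implicit.
Unset Printing Implicit Defensive.

Import GRing.Theory.
Local Open Scope ring_scope.
Local Open Scope quotient_scope.

Definition image_of (A B : Type) (f : A -> B) (y : B) : Prop :=
  exists x : A, f x = y.

Definition surj (A B : Type) (f : A -> B) : Prop := forall y, image_of f y.

Definition exact_at (A B C : zmodType) (f : A -> B) (g : B -> C) : Prop :=
  forall y : B, g y = 0 <-> image_of f y.

Definition is_kernel (R : pzRingType) (K A B : lmodType R)
    (f : {linear K -> A}) (g : A -> B) : Prop :=
  injective f /\ exact_at f g.

(** Left R-modules are [lmodType R]; right R-modules are [lmodType R^c],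
    where x.r is written [(r : R^c) *: x]. *)

Definition projective_module (R : pzRingType) (P : lmodType R) : Prop :=
  forall (A B : lmodType R) (g : {linear A -> B}) (f : {linear P -> B}),
    surj g -> exists h : {linear P -> A}, forall x, g (h x) = f x.

Definition injective_module (R : pzRingType) (E : lmodType R) : Prop :=
  forall (A B : lmodType R) (j : {linear A -> B}) (f : {linear A -> E}),
    injective j -> exists h : {linear B -> E}, forall x, h (j x) = f x.

(** The tensor product over R of a right module and a left module: the free
    abelian group on [E * A] modulo the subgroup generated by the bilinearity
    and balancing relations. *)

Section Tensor.
Variables (R : pzRingType) (E : lmodType R^c) (A : lmodType R).

Inductive tensor_rel : {freeg (E * A)} -> Prop :=
| tensor_rel0 : tensor_rel 0
| tensor_relB u v : tensor_rel u -> tensor_rel v -> tensor_rel (u - v)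
| tensor_relDl x y a :
    tensor_rel (<< (x + y, a) >> - << (x, a) >> - << (y, a) >>)
| tensor_relDr x a b :
    tensor_rel (<< (x, a + b) >> - << (x, a) >> - << (x, b) >>)
| tensor_relM x (r : R) a :
    tensor_rel (<< ((r : R^c) *: x, a) >> - << (x, r *: a) >>).

Definition tensor_relb : {pred {freeg (E * A)}} := fun u => `[< tensor_rel u >].

Fact tensor_relb_zmod : zmod_closed tensor_relb.
Proof.
split=> [|u v]; first by apply/asboolP; exact: tensor_rel0.
by move=> /asboolP hu /asboolP hv; apply/asboolP; exact: tensor_relB.
Qed.

HB.instance Definition _ :=
  GRing.isZmodClosed.Build {freeg (E * A)} tensor_relb tensor_relb_zmod.

Definition tensor : zmodType := Quotient.quot tensor_relb.

Definition tens (x : E) (a : A) : tensor :=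
  \pi_(Quotient.quot tensor_relb) << (x, a) >>.

Section Lift.
Variables (V : zmodType) (g : E -> A -> V).

Definition balanced : Prop :=
  [/\ forall x y a, g (x + y) a = g x a + g y a,
      forall x a b, g x (a + b) = g x a + g x b &
      forall x (r : R) a, g ((r : R^c) *: x) a = g x (r *: a)].

Definition free_lift (u : {freeg (E * A)}) : V :=
  fglift (fun p : E * A => g p.1 p.2 : zmodule V) u.

(* well defined only for balanced g: see the universal property below *)
Definition tensor_lift (u : tensor) : V :=
  free_lift (repr (u : Quotient.quot tensor_relb)).

End Lift.
End Tensor.

Definition tensor_map (R : pzRingType) (E : lmodType R^c) (A B : lmodType R)
    (f : {linear A -> B}) : tensor E A -> tensor E B :=
  tensor_lift (fun x a => tens x (f a)).

Section TensorTheory.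
Variables (R : pzRingType) (E : lmodType R^c) (A : lmodType R).
Implicit Types (u v : {freeg (E * A)}).

Let pi u : tensor E A := \pi_(Quotient.quot (@tensor_relb R E A)) u.

Let piB u v : pi (u - v) = pi u - pi v.
Proof. by rewrite /pi [in RHS]/tensor !piE. Qed.

Let pi0 : pi 0 = 0.
Proof. by have := piB 0 0; rewrite !subrr. Qed.

Let piD u v : pi (u + v) = pi u + pi v.
Proof. by rewrite -{1}[v]opprK -(sub0r v) !piB pi0 sub0r opprK. Qed.

Let pi_eq u v : tensor_rel (u - v) <-> pi u = pi v.
Proof.
split=> [h|/eqP]; last by rewrite /pi -Quotient.idealrBE => /asboolP.
by apply/eqP; rewrite /pi -Quotient.idealrBE; apply/asboolP.
Qed.

Let pi_repr (w : tensor E A) :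
  pi (repr (w : Quotient.quot (@tensor_relb R E A))) = w.
Proof. exact: reprK. Qed.

Lemma tens_balanced : balanced (@tens R E A).
Proof.
split=> [x y a|x a b|x r a].
- rewrite -[RHS]piD; apply/pi_eq; rewrite opprD addrA; exact: tensor_relDl.
- rewrite -[RHS]piD; apply/pi_eq; rewrite opprD addrA; exact: tensor_relDr.
- by apply/pi_eq; exact: tensor_relM.
Qed.

(* the elements x (x) a generate the tensor product *)
Lemma tensor_ind (P : tensor E A -> Prop) :
    P 0 -> (forall w z, P w -> P z -> P (w - z)) ->
    (forall x a, P (tens x a)) -> forall w, P w.
Proof.
move=> P0 PB Pt w; rewrite -(pi_repr w).
have PN z : P z -> P (- z) by move=> hz; rewrite -sub0r; exact: PB.
have PD y z : P y -> P z -> P (y + z).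
  by move=> hy hz; rewrite -[z]opprK; apply: PB => //; exact: PN.
have pi_nat n (p : E * A) : P (pi << n%:Z *g p >>).
  elim: n => [|n IH]; first by rewrite freegU0 pi0.
  rewrite -addn1 PoszD -freegUD piD; apply: PD => //.
  by case: p {IH} => x a; exact: Pt.
elim/freeg_ind_dom0: (repr _) => [|k p u _ _ IH]; first by rewrite pi0.
rewrite piD; apply: PD => //; case: k => n //.
rewrite NegzE -freegUN -[- _]sub0r piB pi0; exact: PB.
Qed.

Section Universal.
Variables (V : zmodType) (g : E -> A -> V).
Hypothesis gbal : balanced g.

Let free_liftB u v : free_lift g (u - v) = free_lift g u - free_lift g v.
Proof. exact: (lift_is_additive (fun p : E * A => g p.1 p.2 : zmodule V)). Qed.

Let free_liftU x a : free_lift g << (x, a) >> = g x a.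
Proof. by rewrite /free_lift liftU; exact: mulr1z. Qed.

Let free_lift0 u : tensor_rel u -> free_lift g u = 0.
Proof.
have [gDl gDr gM] := gbal.
elim=> {u} [|u v _ hu _ hv|x y a|x a b|x r a]; rewrite ?free_liftB ?free_liftU.
- by have := free_liftB 0 0; rewrite !subrr.
- by rewrite hu hv subrr.
- by rewrite gDl addrAC addrK subrr.
- by rewrite gDr addrAC addrK subrr.
- by rewrite gM subrr.
Qed.

Let tensor_lift_pi u : tensor_lift g (pi u) = free_lift g u.
Proof.
apply/eqP; rewrite -subr_eq0 -free_liftB; apply/eqP/free_lift0/pi_eq.
exact: pi_repr.
Qed.

Lemma tensor_liftE x a : tensor_lift g (tens x a) = g x a.
Proof. by rewrite tensor_lift_pi. Qed.

Lemma tensor_liftB w z :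
  tensor_lift g (w - z) = tensor_lift g w - tensor_lift g z.
Proof. by rewrite -(pi_repr w) -(pi_repr z) -piB !tensor_lift_pi. Qed.

Lemma tensor_lift_unique (h : {additive tensor E A -> V}) :
  (forall x a, h (tens x a) = g x a) -> h =1 tensor_lift g.
Proof.
move=> hE; apply: tensor_ind => [|w z hw hz|x a].
- by rewrite raddf0; have := tensor_liftB 0 0; rewrite !subrr.
- by rewrite raddfB tensor_liftB hw hz.
- by rewrite hE tensor_liftE.
Qed.

End Universal.
End TensorTheory.

Section TensorMapTheory.
Variables (R : pzRingType) (E : lmodType R^c) (A B : lmodType R).
Variables (f : {linear A -> B}).

Let tens_map_balanced : balanced (fun (x : E) a => tens x (f a)).
Proof.
have [tDl tDr tM] := @tens_balanced R E B.
by split=> *; rewrite ?linearD ?linearZ ?tDl ?tDr ?tM.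
Qed.

Lemma tensor_mapE x a : tensor_map f (tens x a) = tens x (f a) :> tensor E B.
Proof. exact: tensor_liftE tens_map_balanced _ _. Qed.

Lemma tensor_mapB (w z : tensor E A) :
  tensor_map f (w - z) = tensor_map f w - tensor_map f z.
Proof. exact: tensor_liftB tens_map_balanced _ _. Qed.

End TensorMapTheory.

Section Modules.
Variable R : pzRingType.
Implicit Types (M Q : lmodType R) (X : lmodType R -> Prop).

Record complex := Complex {
  cx_obj :> int -> lmodType R;
  cx_diff : forall i : int, {linear cx_obj (i + 1) -> cx_obj i};
  cx_diff2 : forall i (x : cx_obj (i + 1 + 1)),
    cx_diff i (cx_diff (i + 1) x) = 0 }.

Definition acyclic (P : complex) : Prop :=
  forall i : int, exact_at (cx_diff P (i + 1)) (cx_diff P i).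

Definition tensor_acyclic (E : lmodType R^c) (P : complex) : Prop :=
  forall i : int, exact_at (@tensor_map R E _ _ (cx_diff P (i + 1)))
                           (@tensor_map R E _ _ (cx_diff P i)).

(* exactness of Hom(P_i, Q) -> Hom(P_(i+1), Q) -> Hom(P_(i+2), Q) for all i *)
Definition hom_acyclic (P : complex) Q : Prop :=
  forall (i : int) (f : {linear P (i + 1) -> Q}),
    (forall x, f (cx_diff P (i + 1) x) = 0) <->
    (exists g : {linear P i -> Q}, forall x, g (cx_diff P i x) = f x).

Definition is_syzygy M (P : complex) : Prop :=
  exists (i : int) (f : {linear M -> P (i + 1)}), is_kernel f (cx_diff P i).

Definition PGF M : Prop :=
  exists P : complex,
    [/\ forall i, projective_module (P i), acyclic P,
        forall E : lmodType R^c, injective_module E -> tensor_acyclic E P &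
        is_syzygy M P].

Definition Gprojective M : Prop :=
  exists P : complex,
    [/\ forall i, projective_module (P i), acyclic P,
        forall Q, projective_module Q -> hom_acyclic P Q &
        is_syzygy M P].

(* An exact sequence 0 -> G_n -> ... -> G_0 -> M -> 0 with all G_i in X, stored
   as a sequence indexed by nat whose terms beyond n are zero modules. *)
Definition has_resolution X M (n : nat) : Prop :=
  exists (G : nat -> lmodType R) (d : forall i, {linear G i.+1 -> G i})
         (e : {linear G 0%N -> M}),
    [/\ forall i, (i <= n)%N -> X (G i),
        forall i, (n < i)%N -> forall x : G i, x = 0,
        surj e, exact_at (d 0%N) e &
        forall i, exact_at (d i.+1) (d i)].

(* The least length of a resolution by modules in X; None stands for oo. *)
Definition resdim X M : option nat :=
  match pselect (exists n, `[< has_resolution X M n >]) with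
  | left h => Some (ex_minn h)
  | right _ => None
  end.

Definition pd M : option nat := resdim (@projective_module R) M.
Definition PGFdim M : option nat := resdim PGF M.
Definition Gpd M : option nat := resdim Gprojective M.

Lemma resdim_Some X M n :
  resdim X M = Some n <->
  has_resolution X M n /\ forall m, has_resolution X M m -> (n <= m)%N.
Proof.
rewrite /resdim; case: pselect => [h|h]; last first.
  by split=> // -[hn _]; case: h; exists n; apply/asboolP.
case: ex_minnP => k hk kmin; split=> [[<-]|[hn nmin]].
  by split=> [|m hm]; [exact/asboolP | apply/kmin/asboolP].
congr Some; apply/eqP; rewrite eqn_leq kmin ?nmin //; exact/asboolP.
Qed.

Lemma resdim_None X M :
  resdim X M = None <-> forall n, ~ has_resolution X M n.
Proof.
rewrite /resdim; case: pselect => [h|h]; split=> //.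
  by move=> H; have [n hn] := h; case: (H n); exact/asboolP.
by move=> _ n hn; apply: h; exists n; apply/asboolP.
Qed.

End Modules.

(* Main.v *)
From HB Require Import structures.
From mathcomp Require Import all_boot all_algebra.
From mathcomp Require Import ring_quotient.
From mathcomp Require Import boolp classical_sets functions.
Require Import Defs.

(** The heart of the matter is that a PGF-module [M] satisfies [Ext^1(M, Q) = 0] for [Q] projective.
    Exactness of [I (x) P] for all powers [I] of the character module of [R] is equivalent, by
    separating characters, to a uniform local solvability property of [P] with respect to [R]:
    a map to [R] that vanishes on a suitable finite set agrees on a given finite set with a map
    that factors through the differential.  This property is inherited by projective modules [Y],
    by reduced powers of [Y] over finite subsets of [P], and by the cokernel of the diagonal
    embedding of [Y] in such a power.  A cocycle with values in [Y] becomes a coboundary in the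
    reduced power, so iterating gives a chain map from [P] to a pure exact coresolution of [Q].
    By Neeman's theorem that chain map is null-homotopic: extend a homotopy one finitely generated
    piece at a time by Zorn's lemma, purity solving the finite systems that arise.  The null-homotopy
    gives the vanishing of [Ext^1].

    Hence PGF-modules are Gorenstein projective, and both equalities follow by dimension shifting:
    a module of finite PGF-dimension [n] embeds in a module of projective dimension at most [n] with
    PGF cokernel, and a module of finite projective dimension that is a retract of [A], up to maps
    factoring through projectives, has projective dimension at most the Gorenstein projective
    dimension of [A]. *)

Set Implicit Arguments.
Unset Strict Implicit.
Unset Printing Implicit Defensive.

Import GRing.Theory Num.Theory.
Local Open Scope ring_scope.

(** * Modules *)

Definition submodule (R : pzRingType) (M : lmodType R) (N : M -> Prop) : Prop :=
  [/\ N 0, forall x y, N x -> N y -> N (x - y) & forall r x, N x -> N (r *: x)].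

Lemma submoduleD (R : pzRingType) (M : lmodType R) (N : M -> Prop) x y :
  submodule N -> N x -> N y -> N (x + y).
Proof.
case=> N0 NB _ hx hy; rewrite -[y]opprK -[- y]sub0r.
by apply: (NB) => //; apply: NB.
Qed.

Section Submodule.
Variables (R : pzRingType) (M : lmodType R) (N : M -> Prop).
Hypothesis subN : submodule N.

Definition sub_pred : {pred M} := fun x => `[< N x >].

Fact sub_pred_closed : subsemimod_closed sub_pred.
Proof.
have [N0 NB NZ] := subN; split; first split=> [|x y /asboolP hx /asboolP hy].
- exact/asboolP.
- by apply/asboolP; apply: submoduleD.
- by move=> r x /asboolP hx; apply/asboolP/NZ.
Qed.

Fact sub_pred_oppr : oppr_closed sub_pred.
Proof.
have [N0 NB NZ] := subN => x /asboolP hx.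
by apply/asboolP; rewrite -sub0r; exact: NB.
Qed.

HB.instance Definition _ :=
  GRing.isSubSemiModClosed.Build R M sub_pred sub_pred_closed.
HB.instance Definition _ :=
  GRing.isOppClosed.Build M sub_pred sub_pred_oppr.

Record subT := SubT { sub_val :> M; sub_valP : sub_val \in sub_pred }.
HB.instance Definition _ := [isSub for sub_val].
HB.instance Definition _ := [Choice of subT by <:].
HB.instance Definition _ := [SubChoice_isSubZmodule of subT by <:].
HB.instance Definition _ := [SubZmodule_isSubLmodule of subT by <:].

Lemma submodule_ex : exists (K : lmodType R) (i : {linear K -> M}),
  injective i /\ forall x, N x <-> image_of i x.
Proof.
exists subT, (val : {linear subT -> M}); split; first exact: val_inj.
move=> x; split=> [hx|[y <-]]; last by apply/asboolP/(valP y).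
by exists (SubT (asboolT hx)).
Qed.

End Submodule.

Section Quotient.
Variables (R : pzRingType) (M : lmodType R) (N : M -> Prop).
Hypothesis subN : submodule N.

Definition quot_pred : {pred M} := fun x => `[< N x >].

Fact quot_pred_zmod : zmod_closed quot_pred.
Proof.
have [N0 NB _] := subN; split=> [|x y /asboolP hx /asboolP hy]; first exact/asboolP.
by apply/asboolP/NB.
Qed.

HB.instance Definition _ := GRing.isZmodClosed.Build M quot_pred quot_pred_zmod.

Definition quotT := Quotient.quot quot_pred.
HB.instance Definition _ := GRing.Zmodule.on quotT.

Let pi (x : M) : quotT := \pi_(Quotient.quot quot_pred)%qT x.

Let piB x y : pi (x - y) = pi x - pi y.
Proof. by rewrite /pi !piE. Qed.

Let pi_eq x y : pi x = pi y <-> N (x - y).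
Proof.
split=> [/eqP|h]; first by rewrite /pi -Quotient.idealrBE => /asboolP.
by apply/eqP; rewrite /pi -Quotient.idealrBE; apply/asboolP.
Qed.

Let piK (x : quotT) : pi (repr (x : Quotient.quot quot_pred)) = x.
Proof. exact: reprK. Qed.

Let pi0 : pi 0 = 0. Proof. by have := piB 0 0; rewrite !subrr. Qed.
Let piD x y : pi (x + y) = pi x + pi y.
Proof. by rewrite -{1}[y]opprK -[- y]sub0r !piB pi0 sub0r opprK. Qed.

Let scale (r : R) (x : quotT) : quotT :=
  pi (r *: repr (x : Quotient.quot quot_pred)).

Let scale_pi r x : scale r (pi x) = pi (r *: x).
Proof.
have [_ _ NZ] := subN.
by apply/pi_eq; rewrite -scalerBr; apply/NZ/pi_eq/piK.
Qed.

Let scaleA r s v : scale r (scale s v) = scale (r * s) v.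
Proof. by rewrite -(piK v) !scale_pi scalerA. Qed.
Let scale1 : left_id 1 scale.
Proof. by move=> v; rewrite -(piK v) scale_pi scale1r. Qed.
Let scaleDr : right_distributive scale +%R.
Proof.
by move=> r v w; rewrite -(piK v) -(piK w) -piD !scale_pi scalerDr piD.
Qed.
Let scaleDl v : {morph scale^~ v : r s / r + s}.
Proof. by move=> r s; rewrite -(piK v) !scale_pi scalerDl piD. Qed.

HB.instance Definition _ := GRing.Zmodule_isLmodule.Build R quotT
  scaleA scale1 scaleDr scaleDl.

Let pi_linear : linear pi.
Proof. by move=> r x y; rewrite piD -scale_pi. Qed.

HB.instance Definition _ := GRing.isLinear.Build R M quotT *:%R pi pi_linear.

Lemma quotient_ex : exists (Q : lmodType R) (p : {linear M -> Q}),
  surj p /\ forall x, p x = 0 <-> N x.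
Proof.
exists quotT, pi; split=> [y|x]; first by exists (repr (y : Quotient.quot quot_pred)); exact: piK.
by rewrite -{2}[x]subr0 -pi_eq pi0.
Qed.

End Quotient.

Lemma linear_ex (R : pzRingType) (A B : lmodType R) (f : A -> B) :
  linear f -> exists g : {linear A -> B}, g =1 f.
Proof.
move=> hf.
pose g : {linear A -> B} := HB.pack f (GRing.isLinear.Build R A B *:%R f hf).
by exists g.
Qed.

(** Choice turns a total, single-valued relation into a function, and compatibility with linear
    combinations makes it linear. This serves for maps that are only characterised by an existence
    statement. *)
Lemma linear_graph (R : pzRingType) (A B : lmodType R) (G : A -> B -> Prop) :
  (forall x, exists y, G x y) ->
  (forall x y y', G x y -> G x y' -> y = y') ->
  (forall r x x' y y', G x y -> G x' y' -> G (r *: x + x') (r *: y + y')) ->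
  exists f : {linear A -> B}, forall x, G x (f x).
Proof.
move=> Gtot Gfun Glin; have [f fG] := choice Gtot.
have flin : linear f by move=> r x y; apply: Gfun (fG _) _; exact: Glin.
by have [g gE] := linear_ex flin; exists g => x; rewrite gE.
Qed.

Section Linear.
Variable R : pzRingType.
Implicit Types A B C D : lmodType R.

Lemma lin_inj A B (f : {linear A -> B}) :
  (forall x, f x = 0 -> x = 0) -> injective f.
Proof.
by move=> h x y e; apply/eqP; rewrite -subr_eq0; apply/eqP/h; rewrite linearB e subrr.
Qed.

Lemma inj_lin0 A B (f : {linear A -> B}) x : injective f -> f x = 0 -> x = 0.
Proof. by move=> fi e; apply: fi; rewrite linear0. Qed.

Lemma factor_surj A B C (p : {linear A -> B}) (f : {linear A -> C}) :
  surj p -> (forall x, p x = 0 -> f x = 0) ->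
  exists g : {linear B -> C}, forall x, g (p x) = f x.
Proof.
move=> ps pf.
have [g gP] : exists g : {linear B -> C}, forall y, exists2 x, p x = y & f x = g y.
  apply: (@linear_graph _ _ _ (fun y z => exists2 x, p x = y & f x = z)).
  - by move=> y; have [x <-] := ps y; exists (f x), x.
  - move=> y _ _ [x xy <-] [x' xy' <-]; apply/eqP; rewrite -subr_eq0 -linearB.
    by apply/eqP/pf; rewrite linearB xy xy' subrr.
  - by move=> r _ _ _ _ [x <- <-] [y <- <-]; exists (r *: x + y); rewrite linearP.
exists g => x; have [x' e <-] := gP (p x).
by apply/eqP; rewrite -subr_eq0 -linearB; apply/eqP/pf; rewrite linearB e subrr.
Qed.

Lemma factor_inj A B C (i : {linear A -> B}) (f : {linear C -> B}) :
  injective i -> (forall x, image_of i (f x)) ->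
  exists g : {linear C -> A}, forall x, i (g x) = f x.
Proof.
move=> ii fi; apply: (@linear_graph _ _ _ (fun x y => i y = f x)) => //.
  by move=> x y y' e e'; apply: ii; rewrite e e'.
by move=> r x x' y y' e e'; rewrite !linearP e e'.
Qed.

Definition ses A B C (i : A -> B) (p : B -> C) : Prop :=
  [/\ injective i, surj p & exact_at i p].

Lemma ses0 A B C (i : A -> B) (p : B -> C) x : ses i p -> p (i x) = 0.
Proof. by case=> _ _ h; apply/h; exists x. Qed.

Lemma kernel_ex A B (p : {linear A -> B}) :
  exists (K : lmodType R) (i : {linear K -> A}), injective i /\ exact_at i p.
Proof.
have [|K [i [ii iP]]] := @submodule_ex _ A (fun x => p x = 0).
  split=> [|x y e e'|r x e]; first exact: linear0.
    by rewrite linearB e e' subrr.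
  by rewrite linearZ /= e scaler0.
by exists K, i.
Qed.

Lemma kernel_ses A B (p : {linear A -> B}) : surj p ->
  exists (K : lmodType R) (i : {linear K -> A}), ses i p.
Proof. by move=> ps; have [K [i [ii iP]]] := kernel_ex p; exists K, i. Qed.

Lemma submodule_image A B (i : {linear A -> B}) : submodule (image_of i).
Proof.
split=> [|_ _ [x <-] [y <-]|r _ [x <-]]; first by exists 0; rewrite linear0.
  by exists (x - y); rewrite linearB.
by exists (r *: x); rewrite linearZ.
Qed.

Lemma coker_ses A B (i : {linear A -> B}) : injective i ->
  exists (C : lmodType R) (p : {linear B -> C}), ses i p.
Proof.
by move=> ii; have [C [p [ps pP]]] := quotient_ex (submodule_image i); exists C, p.
Qed.

Lemma pullback_ex A B C (f : {linear A -> C}) (g : {linear B -> C}) :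
  exists (Z : lmodType R) (u : {linear Z -> A}) (v : {linear Z -> B}),
  [/\ forall z, f (u z) = g (v z),
      forall a b, f a = g b -> exists z, u z = a /\ v z = b &
      forall z, u z = 0 -> v z = 0 -> z = 0].
Proof.
have [|Z [i [ii iP]]] := @submodule_ex _ (A * B)%type (fun x => f x.1 = g x.2).
  split=> [|x y e e'|r x e] /=; first by rewrite !linear0.
    by rewrite !linearB e e'.
  by rewrite !linearZ /= e.
have [u uE] : exists u : {linear Z -> A}, u =1 (fun z => (i z).1).
  by apply: linear_ex => r x y; rewrite linearP.
have [v vE] : exists v : {linear Z -> B}, v =1 (fun z => (i z).2).
  by apply: linear_ex => r x y; rewrite linearP.
exists Z, u, v; split=> [z|a b /(iP (a, b)) [z e]|z].
- by rewrite uE vE; apply/iP; exists z.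
- by exists z; rewrite uE vE e.
- by rewrite uE vE => e e'; apply: ii; rewrite linear0; case: (i z) e e' => a b /= -> ->.
Qed.

Lemma pushout_ex A B C (f : {linear C -> A}) (g : {linear C -> B}) :
  exists (Z : lmodType R) (u : {linear A -> Z}) (v : {linear B -> Z}),
  [/\ forall c, u (f c) = v (g c),
      forall a b, u a = v b -> exists c, f c = a /\ g c = b &
      forall z, exists a b, z = u a + v b].
Proof.
have [h hE] : exists h : {linear C -> (A * B)%type}, h =1 (fun c => (f c, - g c)).
  by apply: linear_ex => r x y; rewrite !linearP.
have [Z [p [ps pP]]] := quotient_ex (submodule_image h).
have [u uE] : exists u : {linear A -> Z}, u =1 (fun a => p (a, 0)).
  apply: linear_ex => r x y; rewrite -linearP; congr (p _).
  by congr pair; rewrite /= scaler0 addr0.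
have [v vE] : exists v : {linear B -> Z}, v =1 (fun b => p (0, b)).
  apply: linear_ex => r x y; rewrite -linearP; congr (p _).
  by congr pair; rewrite /= scaler0 addr0.
exists Z, u, v; split=> [c|a b|z].
- apply/eqP; rewrite -subr_eq0 uE vE -linearB; apply/eqP/pP; exists c; rewrite hE.
  by congr pair; rewrite /= ?subr0 ?sub0r.
- move=> /eqP; rewrite -subr_eq0 uE vE -linearB => /eqP/pP [c].
  rewrite hE => -[e1 e2]; exists c; split; first by rewrite e1 subr0.
  by apply: oppr_inj; rewrite e2 sub0r.
- have [[a b] <-] := ps z; exists a, b; rewrite uE vE -linearD.
  by congr (p _); congr pair; rewrite /= ?addr0 ?add0r.
Qed.

End Linear.

(** * Free modules *)

Section Free.
Variables (R : pzRingType) (T : eqType).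

(** The free module is realised as the span of the indicator functions inside the module of all
    functions [T -> R^o]. *)
Let delta (t : T) : T -> R^o := fun x => (t == x)%:R.

Let comb (s : seq (R * T)) : T -> R^o := \sum_(c <- s) c.1 *: delta c.2.

Let comb_submodule : submodule (fun f => exists s, f = comb s).
Proof.
split=> [|_ _ [s ->] [s' ->]|r _ [s ->]].
- by exists [::]; rewrite /comb big_nil.
- exists (s ++ [seq (- c.1, c.2) | c <- s']); rewrite /comb big_cat big_map /=.
  by congr (_ + _); rewrite -sumrN; apply: eq_bigr => c _; rewrite scaleNr.
- exists [seq (r * c.1, c.2) | c <- s]; rewrite /comb big_map scaler_sumr.
  by apply: eq_bigr => c _; rewrite scalerA.
Qed.

Lemma comb_app s x : comb s x = \sum_(c <- s | c.2 == x) c.1.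
Proof.
rewrite /comb; elim: s => [|c s IH]; first by rewrite !big_nil.
rewrite !big_cons addrfctE IH scalrfctE; case: eqP => e.
  by rewrite /delta /= e eqxx [_ *: _]mulr1.
by rewrite /delta /=; case: eqP => // _; rewrite [_ *: _]mulr0 add0r.
Qed.

(** Group the terms by generator: the total coefficient of [x] is the value at [x] of the zero
    function. Hence the linear extension of [t] does not depend on the chosen representation. *)
Lemma comb0 (V : lmodType R) (t : T -> V) s :
  comb s = 0 -> \sum_(c <- s) c.1 *: t c.2 = 0.
Proof.
move=> s0; pose U := undup [seq c.2 | c <- s].
rewrite (eq_big_seq (fun c => \sum_(x <- U | x == c.2) c.1 *: t x)); last first.
  move=> c cs; rewrite -big_filter filter_pred1_uniq ?undup_uniq ?big_seq1 //.
  by rewrite mem_undup; apply: map_f.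
rewrite (exchange_big_dep predT) //= big1 // => x _.
rewrite -scaler_suml; have := comb_app s x; rewrite s0 => e.
by rewrite (eq_bigl (fun c : R * T => c.2 == x)) -?e ?scale0r // => c; rewrite eq_sym.
Qed.

Lemma free_ex : exists (F : lmodType R) (b : T -> F),
  (forall u, exists s : seq (R * T), u = \sum_(c <- s) c.1 *: b c.2) /\
  forall (V : lmodType R) (t : T -> V), exists f : {linear F -> V},
    forall x, f (b x) = t x.
Proof.
have [F [i [ii iP]]] := submodule_ex comb_submodule.
have bP t : exists u, i u = delta t.
  by apply/iP; exists [:: (1, t)]; rewrite /comb big_seq1 scale1r.
have [b bE] := choice bP.
have icomb s : i (\sum_(c <- s) c.1 *: b c.2) = comb s.
  by rewrite linear_sum; apply: eq_bigr => c _; rewrite linearZ /= bE.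
have gen u : exists s : seq (R * T), u = \sum_(c <- s) c.1 *: b c.2.
  have [s sE] : exists s, i u = comb s by apply/iP; exists u.
  by exists s; apply: ii; rewrite icomb.
exists F, b; split=> // V t.
have [f fP] : exists f : {linear F -> V}, forall u, exists2 s : seq (R * T),
    u = \sum_(c <- s) c.1 *: b c.2 & f u = \sum_(c <- s) c.1 *: t c.2.
  apply: (@linear_graph _ _ _ (fun u v => exists2 s : seq (R * T),
    u = \sum_(c <- s) c.1 *: b c.2 & v = \sum_(c <- s) c.1 *: t c.2)).
  - by move=> u; have [s ->] := gen u; exists (\sum_(c <- s) c.1 *: t c.2), s.
  - have sumN (W : lmodType R) (w : T -> W) (s : seq (R * T)) :
        \sum_(c <- [seq (- c.1, c.2) | c <- s]) c.1 *: w c.2 = - \sum_(c <- s) c.1 *: w c.2.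
      by rewrite big_map -sumrN; apply: eq_bigr => c _; rewrite scaleNr.
    move=> _ _ _ [s -> ->] [s' e ->]; apply/eqP; rewrite -subr_eq0 -sumN -big_cat.
    by apply/eqP/comb0; rewrite -icomb big_cat /= sumN e subrr linear0.
  - move=> r _ _ _ _ [s -> ->] [s' -> ->].
    exists ([seq (r * c.1, c.2) | c <- s] ++ s'); rewrite big_cat big_map /= scaler_sumr;
    by congr (_ + _); apply: eq_bigr => c _; rewrite scalerA.
exists f => x; have [s e ->] := fP (b x).
(* The representation [s] of [b x] supplied by the graph need not be the one-term one; adjoining
   [(-1, x)] yields a vanishing combination. *)
have := @comb0 V t ((-1, x) :: s); rewrite -icomb !big_cons /= -e !scaleN1r addNr linear0.
by move=> /(_ erefl) /eqP; rewrite addrC subr_eq0 => /eqP.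
Qed.

End Free.

(** * Projective modules and dual bases *)

Section Projective.
Variable R : pzRingType.
Implicit Types A B C K M P Q : lmodType R.

Lemma free_projective (F : lmodType R) (T : eqType) (b : T -> F) :
  (forall u, exists s : seq (R * T), u = \sum_(c <- s) c.1 *: b c.2) ->
  (forall (V : lmodType R) (t : T -> V), exists f : {linear F -> V},
    forall x, f (b x) = t x) -> projective_module F.
Proof.
move=> gen ext A B g f gs.
have [t tE] := choice (fun x => gs (f (b x))).
have [h hE] := ext A t; exists h => u; have [s ->] := gen u.
by rewrite !linear_sum; apply: eq_bigr => c _; rewrite !linearZ /= hE tE.
Qed.

Lemma enough_proj M : exists (P : lmodType R) (p : {linear P -> M}),
  projective_module P /\ surj p.
Proof.
have [F [b [gen ext]]] := free_ex R M; have [p pE] := ext M id.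
by exists F, p; split=> [|y]; [exact: free_projective gen ext | exists (b y)].
Qed.

Lemma proj_retract P Q (i : {linear P -> Q}) (r : {linear Q -> P}) :
  (forall x, r (i x) = x) -> projective_module Q -> projective_module P.
Proof.
move=> ri hQ A B g f gs; have [h hE] := hQ A B g (f \o r) gs.
by exists (h \o i) => x /=; rewrite hE /= ri.
Qed.

Lemma proj_pair P Q : projective_module P -> projective_module Q ->
  projective_module (P * Q)%type.
Proof.
move=> hP hQ A B g f gs.
have [f1 f1E] : exists f1 : {linear P -> B}, f1 =1 (fun x => f (x, 0)).
  apply: linear_ex => r x y; rewrite -linearP; congr (f _).
  by congr pair; rewrite /= scaler0 addr0.
have [f2 f2E] : exists f2 : {linear Q -> B}, f2 =1 (fun x => f (0, x)).
  apply: linear_ex => r x y; rewrite -linearP; congr (f _).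
  by congr pair; rewrite /= scaler0 addr0.
have [h1 h1E] := hP A B g f1 gs; have [h2 h2E] := hQ A B g f2 gs.
have [h hE] : exists h : {linear (P * Q)%type -> A}, h =1 (fun x => h1 x.1 + h2 x.2).
  by apply: linear_ex => r x y; rewrite !linearP /= scalerDr addrACA.
exists h => -[x y]; rewrite hE linearD h1E h2E f1E f2E -linearD.
by congr (f _); congr pair; rewrite /= ?addr0 ?add0r.
Qed.

Lemma proj_section P M (p : {linear M -> P}) : projective_module P -> surj p ->
  exists s : {linear P -> M}, forall x, p (s x) = x.
Proof. by move=> hP ps; have [s sE] := hP M P p idfun ps; exists s. Qed.

(** Coordinates are finite lists, coming from a section of a free cover. That they depend linearly
    on [x] is encoded by letting every function [t] induce a linear map. *)
Definition dual_basis P (L : P -> seq (R * P)) : Prop :=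
  (forall x, \sum_(c <- L x) c.1 *: c.2 = x) /\
  forall (V : lmodType R) (t : P -> V), linear (fun x => \sum_(c <- L x) c.1 *: t c.2).

Lemma dual_basis_ex P : projective_module P -> exists L : P -> seq (R * P), dual_basis L.
Proof.
move=> hP; have [F [b [gen ext]]] := free_ex R P; have [p pE] := ext P id.
have [|s sE] := @proj_section P F p hP; first by move=> y; exists (b y).
have [coord cE] := choice gen; exists (fun x => coord (s x)).
have sumE (V : lmodType R) (t : P -> V) (f : {linear F -> V}) x :
    (forall x, f (b x) = t x) ->
    \sum_(c <- coord (s x)) c.1 *: t c.2 = f (s x).
  move=> ft; rewrite [s x in RHS]cE linear_sum; apply: eq_bigr => c _.
  by rewrite linearZ /= ft.
split=> [x|V t]; first exact: etrans (sumE P id p x pE) (sE x).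
by have [f fE] := ext V t; move=> r x y; rewrite !(sumE V t f) // !linearP.
Qed.

End Projective.

(** * Characters and tensor products *)

Section Characters.
Variables (A D : zmodType).
Implicit Types (G H : A * D -> Prop).

Definition subgroup (B : zmodType) (W : B -> Prop) : Prop :=
  W 0 /\ forall x y, W x -> W y -> W (x - y).

Lemma subgroupN (B : zmodType) (W : B -> Prop) x : subgroup W -> W x -> W (- x).
Proof. by case=> W0 WB hx; rewrite -sub0r; apply: WB. Qed.

Lemma subgroupD (B : zmodType) (W : B -> Prop) x y :
  subgroup W -> W x -> W y -> W (x + y).
Proof. by move=> hW hx hy; rewrite -[y]opprK; apply: hW.2 => //; apply: subgroupN. Qed.

Lemma subgroup_mulz (B : zmodType) (W : B -> Prop) x n : subgroup W -> W x -> W (x *~ n).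
Proof.
move=> hW hx; have hn k : W (x *+ k).
  by elim: k => [|k IH]; [exact: hW.1 | rewrite mulrS; apply: subgroupD].
by case: n => n; [exact: hn | rewrite NegzE mulrNz; apply: subgroupN => //; exact: hn].
Qed.

Lemma subgroup_int (J : int -> Prop) : subgroup J ->
  exists m : nat, J m /\ forall n, J n -> (m %| n)%Z.
Proof.
move=> hJ; have [ex|nex] := pselect (exists m : nat, (0 < m)%N && `[< J m >]).
  case: (ex_minnP ex) => m /andP[m0 /asboolP Jm] mmin; exists m; split=> // n Jn.
  apply/dvdz_mod0P; apply/eqP; case: eqP => // /eqP r0.
  have rE : (n %% m)%Z = n - m%:Z *~ (n %/ m)%Z.
    by rewrite {2}(divz_eq n m) mulrzz [m%:Z * _]mulrC addrAC subrr add0r.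
  have Jr : J (n %% m)%Z by rewrite rE; apply: hJ.2 => //; apply: subgroup_mulz.
  have m0' : m%:Z != 0 by rewrite eqz_nat -lt0n.
  have := ltz_mod n m0'; have := modz_ge0 n m0'.
  case: (n %% m)%Z Jr r0 => // r Jr r0 _; rewrite [`|_|]/= ltz_nat.
  by rewrite ltnNge mmin // lt0n -(eqz_nat r 0) r0; apply/asboolP.
exists 0%N; split=> [|n Jn]; first exact: hJ.1.
rewrite dvd0z; apply/eqP; case: n Jn => [[//|k]|k] Jn; case: nex; exists k.+1.
  exact/asboolP.
by apply/asboolP; have := subgroupN hJ Jn; rewrite NegzE opprK.
Qed.

(** For a subgroup [G] this makes [G] the graph of a homomorphism defined on a subgroup of [A]. *)
Definition functional G : Prop := forall d, G (0, d) -> d = 0.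

(** The graph is enlarged by the multiples of [(a, c)]; the hypothesis on multiples of [a] keeps it
    single-valued. *)
Lemma graph_extend G a c : subgroup G -> functional G ->
  (forall n d, G (a *~ n, d) -> d = c *~ n) ->
  exists G', [/\ subgroup G', functional G', (forall x, G x -> G' x) & G' (a, c)].
Proof.
move=> hG Gf ac.
exists (fun x => exists y n, G y /\ x = y + (a *~ n, c *~ n)); split.
- split; first by exists 0, 0; split; [exact: hG.1 | rewrite !mulr0z addr0].
  move=> _ _ [y [n [hy ->]]] [y' [n' [hy' ->]]].
  exists (y - y'), (n - n'); split; first exact: hG.2.
  rewrite !mulrzBr opprD addrACA; congr (_ + _).
- move=> d [[x e] [n [hxe [ex ->]]]]; have := @ac (- n) e.
  rewrite (_ : a *~ - n = x); last by apply/eqP; rewrite mulrNz -subr_eq0 -opprD oppr_eq0 addrC -ex.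
  by move=> /(_ hxe) -> /=; rewrite mulrNz addNr.
- by move=> x hx; exists x, 0; rewrite !mulr0z addr0.
- by exists 0, 1; split; [exact: hG.1 | rewrite add0r].
Qed.

Hypothesis divD : forall (d : D) n, (0 < n)%N -> exists e, e *+ n = d.

(** The integers [n] with [a *~ n] in the domain form an ideal, generated by some [m]. Dividing the
    value at [a *~ m] by [m] gives an admissible value at [a]. *)
Lemma graph_step G a : subgroup G -> functional G ->
  exists G' c, [/\ subgroup G', functional G', (forall x, G x -> G' x) & G' (a, c)].
Proof.
move=> hG Gf; have [m [[h Gh] mP]] : exists m : nat, (exists d, G (a *~ m, d)) /\
    forall n : int, (exists d, G (a *~ n, d)) -> (m %| n)%Z.
  apply: (@subgroup_int (fun n => exists d, G (a *~ n, d))).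
  split=> [|x y [d hd] [e he]]; first by exists 0; rewrite mulr0z; exact: hG.1.
  by exists (d - e); rewrite mulrzBr; exact: (hG.2 _ _ hd he).
have [c cE] : exists c, c *+ m = h.
  (* For [m = 0] divisibility says nothing, but then [h] is a value at [0], hence zero. *)
  case: m Gh {mP} => [|m] Gh; first by exists 0; rewrite mulr0n (Gf h).
  exact: divD.
have [|G' [h1 h2 h3 h4]] := @graph_extend G a c hG Gf; last by exists G', c.
move=> n d Gd; have /dvdzP[q nE] := mP n (ex_intro _ d Gd).
have := hG.2 _ _ Gd (subgroup_mulz q hG Gh).
have -> : (a *~ m, h) *~ q = (a *~ n, h *~ q).
  rewrite [LHS]surjective_pairing !raddfMz /= nE mulrC mulrzA.
  by congr pair.
rewrite -[X in G X]/(a *~ n - a *~ n, d - h *~ q) subrr => e; apply/eqP; rewrite -subr_eq0; apply/eqP/Gf.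
by rewrite nE mulrC mulrzA -pmulrn cE.
Qed.

(** Divisible groups are injective: a maximal partial homomorphism, given by Zorn's lemma, is total
    by [graph_step]. *)
Lemma graph_total G : subgroup G -> functional G ->
  exists f : {additive A -> D}, forall a d, G (a, d) -> f a = d.
Proof.
(* [U] joins [G] to every set, so that the empty chain, whose union is empty, still has an upper
   bound extending [G]. *)
move=> hG Gf; pose U (F : set (A * D)) : A * D -> Prop := fun x => G x \/ F x.
have [|F [[UF Uf] Fmax]] := @Zorn_bigcup _ (fun F => subgroup (U F) /\ functional (U F)).
  move=> FF FP Ftot; pose V := U (\bigcup_(X in FF) X)%classic.
  have pick x y : V x -> V y -> exists F, [/\ FF F \/ F = set0, U F x & U F y].
    move=> [hx|[X FX hx]] [hy|[Y FY hy]].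
    - by exists set0; split; [right | left | left].
    - by exists Y; split; [left | left | right].
    - by exists X; split; [left | right | left].
    - have [XY|YX] := Ftot _ _ FX FY.
        by exists Y; split; [left | right; apply: XY | right].
      by exists X; split; [left | right | right; apply: YX].
  have P0 : subgroup (U set0) /\ functional (U set0).
    split; first split; first by left; exact: hG.1.
      by move=> x y [hx|[]] [hy|[]]; left; apply: hG.2.
    by move=> d [hd|[]]; exact: Gf.
  have Pick x y : V x -> V y -> exists F, [/\ subgroup (U F), functional (U F),
      forall z, U F z -> V z, U F x & U F y].
    move=> /pick h /h [X [[FX|->] hx hy]].
      exists X; have [h1 h2] := FP _ FX; split=> // z [hz|hz]; first by left.
      by right; exists X.
    by exists set0; split=> //; [exact: P0.1 | exact: P0.2 | move=> z [hz|[]]; left].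
  split; first split; first by left; exact: hG.1.
    by move=> x y /Pick h /h [X [h1 h2 h3 hx hy]]; apply: h3; apply: h1.2.
  by move=> d hd; have [X [h1 h2 h3 hx hy]] := Pick _ _ hd hd; exact: h2.
have tot a : exists d, U F (a, d).
  have [F' [c [h1 h2 h3 h4]]] := graph_step a UF Uf; exists c.
  have [//|nF] := pselect (U F (a, c)); exfalso; apply: (Fmax F').
    split=> [x hx|E]; first by apply: h3; right.
    by apply: nF; right; apply: E.
  have UE : U F' = F'.
    by rewrite funeqE => x; rewrite propeqE; split=> [[hx|//]|]; [apply: h3; left | right].
  by rewrite UE.
have uniq a d d' : U F (a, d) -> U F (a, d') -> d = d'.
  move=> h h'; apply/eqP; rewrite -subr_eq0; apply/eqP/Uf.
  by have := UF.2 _ _ h h'; rewrite -[X in U F X]/(a - a, d - d') subrr.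
have [f fE] := choice tot.
have fB : zmod_morphism f by move=> a b; apply: (uniq (a - b)) => //; exact: (UF.2 _ _ (fE a) (fE b)).
pose f' : {additive A -> D} := HB.pack f (GRing.isZmodMorphism.Build A D f fB).
by exists f' => a d h; apply: (uniq a); [exact: fE | left].
Qed.

Hypothesis torD : forall m, m != 1%N -> exists2 e : D, e != 0 & e *+ m = 0.

(** The order [m] of [a] modulo [W] (zero if infinite) is not [1], so some nonzero [c] is killed by
    [m]. Sending [W] to [0] and [a] to [c] is consistent, and extends to [A] by divisibility. *)
Lemma character_separation (W : A -> Prop) a : subgroup W -> ~ W a ->
  exists2 f : {additive A -> D}, (forall w, W w -> f w = 0) & f a != 0.
Proof.
move=> hW Wa; have [m [Wm mP]] : exists m : nat, W (a *~ m) /\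
    forall n : int, W (a *~ n) -> (m %| n)%Z.
  apply: (@subgroup_int (fun n => W (a *~ n))).
  split=> [|x y hx hy]; first by rewrite mulr0z; exact: hW.1.
  by rewrite mulrzBr; exact: hW.2.
have [|c c0 cm] := @torD m; first by apply: contra_notN Wa => /eqP m1; rewrite m1 in Wm.
pose G (x : A * D) := W x.1 /\ x.2 = 0.
have hG : subgroup G.
  split; first by split=> //; exact: hW.1.
  by move=> x y [hx hx'] [hy hy']; split; [exact: hW.2 | rewrite /= hx' hy' subrr].
have [||G' [h1 h2 h3 h4]] := @graph_extend G a c hG; first by move=> d [].
  by move=> n d [/= /mP/dvdzP[q ->] ->]; rewrite mulrC mulrzA -pmulrn cm mul0rz.
have [f fE] := graph_total h1 h2; exists f => [w hw|]; last by rewrite (fE _ _ h4).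
by apply/fE/h3; split.
Qed.

End Characters.

(** The rationals modulo the integers: the class of [1 / m] is the torsion element for [m > 1], and
    that of [1 / 2] serves for [m = 0]. *)
Lemma QZ_ex : exists D : zmodType,
  (forall (d : D) n, (0 < n)%N -> exists e, e *+ n = d) /\
  (forall m, m != 1%N -> exists2 e : D, e != 0 & e *+ m = 0).
Proof.
have [|Q [p [ps pP]]] := @quotient_ex int (zmodule rat) (fun x => exists n : int, x = n%:~R :> rat).
  split=> [|_ _ [m ->] [n ->]|r _ [n ->]]; first by exists 0.
    by exists (m - n); rewrite rmorphB.
  by exists (n * r); rewrite intrM -[RHS]/(n%:~R * r%:~R) mulrzr.
exists Q; split=> [d n n0|m m1].
  have [x <-] := ps d; exists (p (x / n%:R : rat)).
  rewrite -raddfMn /=; congr (p _); rewrite -[LHS]mulr_natr divfK //.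
  by rewrite pnatr_eq0 -lt0n.
have main k : (1 < k)%N -> p (k%:R^-1 : rat) != 0.
  move=> k1; apply/eqP => /pP[n]; have k0 : k%:R != 0 :> rat by rewrite pnatr_eq0 -lt0n ltnW.
  move=> /(congr1 ( *%R^~ k%:R)); rewrite mulVf // -[k%:R]/(k%:Z%:~R) -intrM => /eqP.
  rewrite -[1]/(1%:~R : rat) eqr_int eq_sym => /eqP e; have : (k %| 1)%Z by apply/dvdzP; exists n.
  by rewrite dvdzE /= dvdn1 => /eqP k1'; rewrite k1' in k1.
case: m m1 => [|m] m1; first by exists (p (2%:R^-1 : rat)); rewrite ?mulr0n ?main.
exists (p (m.+1%:R^-1 : rat)); first by rewrite main //; case: m m1.
by rewrite -raddfMn /= -[X in p X]mulr_natr mulVf ?pnatr_eq0 //; apply/pP; exists 1.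
Qed.

(** * Powers of the character module of the ring *)

Section CharacterModule.
Variables (R : pzRingType) (D : zmodType) (K : Type).

(** These functions form the [K]-fold power of the character module of [R]. Using the power from the
    start puts a whole family of characters into one injective right module. *)
Definition char_pred : {pred (K -> R -> D)} :=
  fun f => `[< forall k, zmod_morphism (f k) >].

Fact char_pred_closed : zmod_closed char_pred.
Proof.
split=> [|f g /asboolP hf /asboolP hg]; apply/asboolP=> k r s; first by rewrite subr0.
have E t : (f - g) k t = f k t - g k t by [].
by rewrite !E hf hg !opprB addrACA [RHS]addrACA; congr (_ + _); exact: addrC.
Qed.

HB.instance Definition _ :=
  GRing.isZmodClosed.Build (K -> R -> D) char_pred char_pred_closed.

Record charT := CharT { char_val :> K -> R -> D; char_valP : char_val \in char_pred }.
HB.instance Definition _ := [isSub for char_val].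
HB.instance Definition _ := [Choice of charT by <:].
HB.instance Definition _ := [SubChoice_isSubZmodule of charT by <:].

Lemma charB (f : charT) k : zmod_morphism (f k).
Proof. exact: (asboolW (valP f)). Qed.

Lemma charD (f : charT) k r s : f k (r + s) = f k r + f k s.
Proof.
have N u : f k (- u) = - f k u.
  by have := charB f k 0 u; have := charB f k 0 0; rewrite !subrr => ->; rewrite !sub0r.
by rewrite -[s]opprK charB N !opprK.
Qed.

Lemma charP (f g : charT) : (forall k r, f k r = g k r) -> f = g.
Proof. by move=> h; apply: val_inj; apply/funext => k; apply/funext => r; exact: h. Qed.

Lemma charT_ex (f : K -> R -> D) : (forall k, zmod_morphism (f k)) ->
  exists x : charT, forall k r, x k r = f k r.
Proof. by move=> hf; exists (CharT (asboolT hf)). Qed.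

Let scale (r : R^c) (f : charT) : charT.
Proof.
apply: (@CharT (fun k (s : R) => f k ((r : R) * s))).
by apply/asboolP => k s t; rewrite mulrBr charB.
Defined.

Let scaleA r s v : scale r (scale s v) = scale (r * s) v.
Proof. by apply: charP => k t; rewrite /= -[(r * s : R^c)]/((s : R) * r) mulrA. Qed.
Let scale1 : left_id 1 scale.
Proof. by move=> v; apply: charP => k t; rewrite /= mul1r. Qed.
Let scaleDr : right_distributive scale +%R.
Proof. by move=> r v w; apply: charP. Qed.
Let scaleDl v : {morph scale^~ v : r s / r + s}.
Proof.
by move=> r s; apply: charP => k t; rewrite /= mulrDl charD.
Qed.

HB.instance Definition _ := GRing.Zmodule_isLmodule.Build R^c charT
  scaleA scale1 scaleDr scaleDl.

Lemma char_sumE (I : Type) (s : seq I) (f : I -> charT) k r :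
  (\sum_(i <- s) f i) k r = \sum_(i <- s) f i k r.
Proof.
by elim: s => [|i s IH]; rewrite ?big_nil // !big_cons -IH.
Qed.

Hypothesis divD : forall (d : D) n, (0 < n)%N -> exists e, e *+ n = d.

(** A linear map to the power is determined by its components evaluated at [1], which are additive
    maps to [D]. Extend these to [B], then recover a linear map by evaluating at the multiples of
    [b]. *)
Lemma char_injective : injective_module (charT : lmodType R^c).
Proof.
move=> A B j f ji.
have ext k : exists h : {additive B -> D}, forall a, h (j a) = f a k 1.
  pose G (x : B * D) := exists a, x = (j a, f a k 1).
  have [||h hE] := @graph_total B D divD G; last first.
  - by exists h => a; apply: hE; exists a.
  - by move=> d [a []]; rewrite -(linear0 j) => /ji <- ->; rewrite linear0.
  split; first by exists 0; rewrite !linear0.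
  by move=> _ _ [a ->] [b ->]; exists (a - b); rewrite !linearB.
have [h hE] := choice ext.
have [|g gE] := choice (fun b : B => @charT_ex (fun k (r : R) => h k ((r : R^c) *: b)) _).
  move=> b k r s; rewrite -raddfB; congr (h k _); exact: (scalerBl (r : R^c) (s : R^c)).
have glin : linear (g : B -> (charT : lmodType R^c)).
  move=> r x y; apply: charP => k s; rewrite -[RHS]/(g x k ((r : R) * s) + g y k s) !gE.
  by rewrite scalerDr raddfD scalerA.
have [g' g'E] := linear_ex glin; exists g' => a; apply: charP => k r.
by rewrite g'E gE -linearZ hE linearZ -[LHS]/(f a k ((r : R) * 1)) mulr1.
Qed.

End CharacterModule.

(** * Tensor maps and right exactness *)

Section TensorFacts.
Variables (R : pzRingType) (E : lmodType R^c).
Implicit Types A B C : lmodType R.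

Lemma tensor_map_additive A B (f : {linear A -> B}) :
  exists g : {additive tensor E A -> tensor E B}, g =1 @tensor_map R E A B f.
Proof.
pose g : {additive tensor E A -> tensor E B} := HB.pack (@tensor_map R E A B f)
  (GRing.isZmodMorphism.Build _ _ (@tensor_map R E A B f) (tensor_mapB f)).
by exists g.
Qed.

Lemma tens_suml A (I : Type) (s : seq I) (x : I -> E) (a : A) :
  tens (\sum_(i <- s) x i) a = \sum_(i <- s) tens (x i) a.
Proof.
have [tDl _ _] := @tens_balanced R E A; elim/big_rec2: _ => [|i y z _ <-]; last exact: tDl.
by have := tDl 0 0 a; rewrite addr0 => /eqP; rewrite -subr_eq0 opprD addNKr oppr_eq0 => /eqP.
Qed.

Lemma tens_sumr A (I : Type) (s : seq I) (x : E) (a : I -> A) :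
  tens x (\sum_(i <- s) a i) = \sum_(i <- s) tens x (a i).
Proof.
have [_ tDr _] := @tens_balanced R E A; elim/big_rec2: _ => [|i y z _ <-]; last exact: tDr.
by have := tDr x 0 0; rewrite addr0 => /eqP; rewrite -subr_eq0 opprD addNKr oppr_eq0 => /eqP.
Qed.

Lemma tensN A (x : E) (a : A) : tens (- x) a = - tens x a.
Proof.
have := tens_suml [:: x; - x] id a; rewrite !big_cons !big_nil /= addr0 subrr.
have := @tens_suml A nat [::] (fun=> 0) a; rewrite !big_nil => -> /eqP.
by rewrite addr0 eq_sym addrC addr_eq0 => /eqP.
Qed.

Lemma tensor_sum A (w : tensor E A) :
  exists s : seq (E * A), w = \sum_(c <- s) tens c.1 c.2.
Proof.
elim/tensor_ind: w => [|_ _ [s ->] [s' ->]|x a].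
- by exists [::]; rewrite big_nil.
- exists (s ++ [seq (- c.1, c.2) | c <- s']); rewrite big_cat big_map -sumrN /=.
  by congr (_ + _); apply: eq_bigr => c _; rewrite tensN.
- by exists [:: (x, a)]; rewrite big_seq1.
Qed.

Lemma tensor_map_sum A B (f : {linear A -> B}) (s : seq (E * A)) :
  tensor_map f (\sum_(c <- s) tens c.1 c.2) = \sum_(c <- s) tens c.1 (f c.2) :> tensor E B.
Proof.
have [g gE] := tensor_map_additive f; rewrite -gE raddf_sum.
by apply: eq_bigr => c _; rewrite gE tensor_mapE.
Qed.

Lemma tensor_map_comp A B C (f : {linear A -> B}) (g : {linear B -> C})
    (h : {linear A -> C}) (w : tensor E A) : (forall x, h x = g (f x)) ->
  tensor_map h w = tensor_map g (tensor_map f w).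
Proof.
move=> hE; have [s ->] := tensor_sum w; rewrite !tensor_map_sum.
have := @tensor_map_sum B C g [seq (c.1, f c.2) | c <- s].
rewrite !big_map /= => ->; by apply: eq_bigr => c _; rewrite hE.
Qed.

Lemma tensor_map_id A (f : {linear A -> A}) (w : tensor E A) :
  (forall x, f x = x) -> tensor_map f w = w.
Proof.
move=> fE; have [s ->] := tensor_sum w; rewrite tensor_map_sum.
by apply: eq_bigr => c _; rewrite fE.
Qed.

Lemma tensor_map_null A B (f : {linear A -> B}) (w : tensor E A) :
  (forall x, f x = 0) -> tensor_map f w = 0.
Proof.
move=> fE; have [s ->] := tensor_sum w; rewrite tensor_map_sum big1 // => c _.
by rewrite fE; have := @tens_sumr B nat [::] c.1 (fun=> 0); rewrite !big_nil.
Qed.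

Lemma tensor_map_surj A B (f : {linear A -> B}) : surj f -> surj (@tensor_map R E A B f).
Proof.
move=> fs w; have [s ->] := tensor_sum w; have [g gE] := choice fs.
exists (\sum_(c <- [seq (c.1, g c.2) | c <- s]) tens c.1 c.2).
by rewrite tensor_map_sum big_map; apply: eq_bigr => c _; rewrite /= gE.
Qed.

Lemma lift_sum A (V : zmodType) (g : E -> A -> V) (s : seq (E * A)) : balanced g ->
  tensor_lift g (\sum_(c <- s) tens c.1 c.2) = \sum_(c <- s) g c.1 c.2.
Proof.
move=> gb; pose h : {additive tensor E A -> V} := HB.pack (tensor_lift g)
  (GRing.isZmodMorphism.Build _ _ (tensor_lift g) (tensor_liftB gb)).
rewrite -[LHS]/(h _) raddf_sum; apply: eq_bigr => c _; exact: tensor_liftE.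
Qed.

(** Otherwise a character separates [w] from the image. As it kills the image, it descends along a
    set-theoretic section of [p] to a balanced map on [E] and [C], so its value at [w] depends only
    on [tensor_map p w = 0]. *)
Lemma tensor_right_exact A B C (i : {linear A -> B}) (p : {linear B -> C})
    (w : tensor E B) : surj p -> exact_at i p -> tensor_map p w = 0 ->
  exists v, tensor_map i v = w.
Proof.
move=> ps ip w0; have [D [divD torD]] := QZ_ex.
have [//|nw] := pselect (exists v, tensor_map i v = w); exfalso.
have [tDl tDr tM] := @tens_balanced R E B.
have [|chi chi0 /eqP[]] := character_separation divD torD (W := image_of (@tensor_map R E A B i)) _ nw.
  split; first by exists 0; have [g gE] := tensor_map_additive i; rewrite -gE raddf0.
  by move=> _ _ [x <-] [y <-]; exists (x - y); rewrite tensor_mapB.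
have chip x b b' : p b = p b' -> chi (tens x b) = chi (tens x b').
  move=> e; have /ip [a aE] : p (b - b') = 0 by rewrite linearB e subrr.
  have -> : b = i a + b' by rewrite aE subrK.
  by rewrite tDr raddfD chi0 ?add0r //; exists (tens x a); rewrite tensor_mapE.
have [sec secE] := choice ps.
have gb : balanced (fun (x : E) c => chi (tens x (sec c))).
  split=> [x y c|x c c'|x r c]; first by rewrite tDl raddfD.
    by rewrite -raddfD -tDr; apply: chip; rewrite linearD !secE.
  by rewrite tM; apply: chip; rewrite linearZ /= !secE.
have [s wE] := tensor_sum w.
have := lift_sum [seq (c.1, p c.2) | c <- s] gb.
rewrite !big_map /= -tensor_map_sum -wE w0 => e.
rewrite wE raddf_sum (eq_bigr (fun c => chi (tens c.1 (sec (p c.2))))) => [|c _].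
  by rewrite -e; have := tensor_liftB gb 0 0; rewrite !subrr.
by apply: chip; rewrite secE.
Qed.

End TensorFacts.

(** * Local solvability over the ring *)

Section LocalSolvability.
Variable R : pzRingType.

(** Only finitely many generators occur in the coordinates of the members of [S]; [phi u] collects
    the coefficients of [u]. *)
Lemma dual_basis_fin (P : lmodType R) (S : seq P) : projective_module P ->
  exists (U : seq P) (phi : P -> {linear P -> R^o}),
    forall p, p \in S -> p = \sum_(u <- U) (phi u p : R) *: u.
Proof.
move=> hP; have [L [LE Llin]] := dual_basis_ex hP.
have phiP u : exists f : {linear P -> R^o}, forall x, f x = \sum_(c <- L x | c.2 == u) c.1.
  have [f fE] := linear_ex (Llin R^o (fun x => (x == u)%:R)).
  exists f => x; rewrite fE [RHS]big_mkcond; apply: eq_bigr => c _.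
  by case: eqP => _; rewrite ?[_ *: _]mulr1 ?[_ *: _]mulr0.
have [phi phiE] := choice phiP.
pose U := undup (flatten [seq [seq c.2 | c <- L x] | x <- S]).
exists U, phi => p pS; rewrite -[LHS]LE.
rewrite (eq_big_seq (fun c => \sum_(u <- U | u == c.2) c.1 *: u)); last first.
  move=> c cs; rewrite -big_filter filter_pred1_uniq ?undup_uniq ?big_seq1 //.
  rewrite mem_undup; apply/flattenP; exists [seq c.2 | c <- L p]; last exact: map_f.
  exact: (map_f (fun x => [seq c.2 | c <- L x])).
rewrite (exchange_big_dep predT) //=; apply: eq_bigr => u _.
rewrite -scaler_suml phiE; congr (_ *: _).
by apply: eq_bigl => c; rewrite eq_sym.
Qed.

(** If every [T] fails, pick for each a bad map [y T] and a character [chi T] that kills the tuples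
    of values of maps through [d] but not the tuple of [y T]. All the [chi T] together define a
    tensor [xi] killed by [d]. A preimage of [xi] involves finitely many elements of [M], and the
    coordinate at this finite set gives a contradiction. *)
Lemma local_solvability_ring (M P P' : lmodType R) (i : {linear M -> P})
    (d : {linear P -> P'}) : projective_module P' ->
  (forall E : lmodType R^c, injective_module E -> forall w : tensor E P,
    tensor_map d w = 0 -> exists v, tensor_map i v = w) ->
  forall S : seq P, exists T : seq M, forall y : {linear P -> R^o},
    (forall t, t \in T -> y (i t) = 0) ->
    exists w : {linear P' -> R^o}, forall s, s \in S -> y s = w (d s).
Proof.
move=> hP' ex S; have [D [divD torD]] := QZ_ex.
apply: contrapT => /forallNP nT.
have {}nT (T : seq M) : exists y : {linear P -> R^o}, (forall t, t \in T -> y (i t) = 0) /\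
    ~ exists w : {linear P' -> R^o}, forall s, s \in S -> y s = w (d s).
  by have /existsNP[y /not_implyP[h1 h2]] := nT T; exists y.
have [y yP] := choice nT; pose n := size S.
pose sn (k : 'I_n) := nth 0 S k.
pose W (a : {ffun 'I_n -> R}) := exists w : {linear P' -> R^o}, a = [ffun k => w (d (sn k))].
have hW : subgroup W.
  split; first by exists \0; apply/ffunP => k; rewrite !ffunE.
  by move=> _ _ [w ->] [w' ->]; exists (w \- w'); apply/ffunP => k; rewrite !ffunE.
pose a (T : seq M) : {ffun 'I_n -> R} := [ffun k => y T (sn k)].
have aW T : ~ W (a T).
  case=> w /ffunP aE; case: (yP T) => _; apply; exists w => s sS.
  have sn' : (index s S < n)%N by rewrite index_mem.
  by have := aE (Ordinal sn'); rewrite !ffunE /sn nth_index.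
have chiP T : exists f : {additive {ffun 'I_n -> R} -> D},
    (forall w, W w -> f w = 0) /\ f (a T) != 0.
  by have [f f1 f2] := character_separation divD torD hW (aW T); exists f.
have [chi {}chiP] := choice chiP.
(* The power has one factor for each candidate [T], so a single injective module records all the
   characters. *)
pose I : lmodType R^c := charT R D (seq M).
pose del (k : 'I_n) (r : R) : {ffun 'I_n -> R} := [ffun k' => if k' == k then r else 0].
have delB k : zmod_morphism (del k).
  by move=> r s; apply/ffunP => k'; rewrite !ffunE; case: eqP; rewrite ?subr0.
have del_sum (f : 'I_n -> R) : \sum_k del k (f k) = [ffun k => f k].
  apply/ffunP => k; rewrite sum_ffunE ffunE (bigD1 k) //= big1 => [|k' nk].
    by rewrite ffunE eqxx addr0.
  by rewrite ffunE eq_sym (negPf nk).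
have [|x xE] := choice (fun k => @charT_ex R D (seq M) (fun T r => chi T (del k r)) _).
  by move=> k T r s; rewrite delB raddfB.
pose xi : tensor I P := \sum_(c <- [seq (x k : I, sn k) | k <- enum 'I_n]) tens c.1 c.2.
have [|zeta zetaE] := ex I (char_injective divD) xi.
  (* In dual-basis coordinates of [P'], each coefficient of the image of [xi] evaluates every
     [chi T] on tuples in [W], and so vanishes. *)
  have [U [phi phiE]] := dual_basis_fin [seq d s | s <- S] hP'.
  rewrite tensor_map_sum big_map big_enum /=.
  rewrite (eq_bigr (fun k => \sum_(u <- U) tens ((phi u (d (sn k)) : R^c) *: (x k : I)) u)).
    rewrite exchange_big big1 //= => u _; rewrite -big_enum -tens_suml /=.
    rewrite (_ : \sum_(_ <- _) _ = 0) //; last first.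
      apply: charP => T r; rewrite char_sumE big_enum /=.
      rewrite (eq_bigr (fun k => chi T (del k (phi u (d (sn k)) * r)))) => [|k _].
        rewrite -raddf_sum del_sum; apply: (chiP T).1.
        have [w wE] : exists w : {linear P' -> R^o}, w =1 (fun p => phi u p * r).
          by apply: linear_ex => s p q; rewrite linearP mulrDl -[RHS]/(s * _ + _) mulrA.
        by exists w; apply/ffunP => k; rewrite !ffunE wE.
      exact: xE.
    by have := @tens_suml R I _ nat [::] (fun=> 0) u; rewrite !big_nil.
  move=> k _; rewrite {1}(phiE (d (sn k))) ?tens_sumr; last first.
    by apply: map_f; apply: mem_nth.
  by have [_ _ tM] := @tens_balanced R I P'; apply: eq_bigr => u _; rewrite tM.
(* [T] is the finite set of elements of [M] occurring in the preimage. Pairing the [T]-coordinate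
   with [y T] gives [chi T (a T)] on [xi], but zero on the preimage because [y T] vanishes on
   [T]. *)
have [s zE] := tensor_sum zeta; pose T := [seq c.2 | c <- s].
have gb : balanced (fun (z : I) p => z T (y T p)).
  split=> [z z' p|z p p'|z r p]; first by [].
    by rewrite linearD charD.
  by rewrite linearZ.
case/eqP: (chiP T).2.
have := lift_sum [seq (c.1, i c.2) | c <- s] gb.
rewrite !big_map /= -tensor_map_sum -zE zetaE lift_sum // big_map big_enum /= => e.
rewrite /a -(del_sum (fun k => y T (sn k))) raddf_sum.
rewrite (eq_bigr (fun k => x k T (y T (sn k)))) => [|k _]; last by rewrite xE.
rewrite e big1_seq // => c /andP[_ cs]; rewrite (yP T).1; last exact: map_f.
by have := charB c.1 T 0 0; rewrite !subrr.
Qed.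

End LocalSolvability.

(** * Reduced powers *)

Lemma ex_choice (A B : Type) (P : A -> B -> Prop) :
  (forall x, exists y, P x y) -> exists f, forall x, P x (f x).
Proof. by move/choice=> [f fP]; exists f. Qed.

Section Combinations.
Variables (R : pzRingType) (B : eqType).
Implicit Types (V W : lmodType R) (l : seq (R * B)).

Definition comb V l (t : B -> V) : V := \sum_(u <- l) u.1 *: t u.2.

Lemma eq_comb V l (t t' : B -> V) : (forall u, u \in l -> t u.2 = t' u.2) ->
  comb l t = comb l t'.
Proof. by move=> h; apply: eq_big_seq => u ul; rewrite h. Qed.

Lemma combB V l (t t' : B -> V) : comb l (fun y => t y - t' y) = comb l t - comb l t'.
Proof. by rewrite /comb -sumrB; apply: eq_bigr => u _; rewrite scalerBr. Qed.

Lemma comb_null V l : comb l (fun=> 0 : V) = 0.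
Proof. by rewrite /comb big1 // => u _; rewrite scaler0. Qed.

Lemma linear_comb V W (f : {linear V -> W}) l (t : B -> V) :
  f (comb l t) = comb l (fun y => f (t y)).
Proof. by rewrite linear_sum; apply: eq_bigr => u _; rewrite linearZ. Qed.

Lemma comb_filter V (a : pred B) l (t : B -> V) : (forall y, ~~ a y -> t y = 0) ->
  comb [seq u <- l | a u.2] t = comb l t.
Proof.
move=> h; rewrite /comb big_filter big_mkcond; apply: eq_bigr => u _.
by case: ifPn => // /h ->; rewrite scaler0.
Qed.

End Combinations.

(** Purity in terms of equations: a finite system with constants in [Y] that is solvable in [X] is
    solvable in [Y]. [N] lists the equations and [B] indexes the unknowns, of which each equation
    involves finitely many. *)
Definition pure (R : pzRingType) (Y X : lmodType R) (f : Y -> X) : Prop :=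
  forall (I B : eqType) (N : seq I) (L : I -> seq (R * B)) (z : B -> X) (c : I -> Y),
    (forall x, x \in N -> comb (L x) z = f (c x)) ->
    exists z' : B -> Y, forall x, x \in N -> comb (L x) z' = c x.

Section ReducedPower.
Variables (R : pzRingType) (Y : lmodType R) (K : eqType).

(** Membership in the filter generated by the cones of finite sets containing a given one; lists
    stand for finite sets. *)
Definition eventually (E : seq K -> Prop) : Prop :=
  exists S0 : seq K, forall S : seq K, {subset S0 <= S} -> E S.

Lemma eventually_and (E F : seq K -> Prop) : eventually E -> eventually F ->
  eventually (fun S => E S /\ F S).
Proof.
move=> [S0 h0] [S1 h1]; exists (S0 ++ S1) => S sub; split.
  by apply: h0 => x xS; apply: sub; rewrite mem_cat xS.
by apply: h1 => x xS; apply: sub; rewrite mem_cat xS orbT.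
Qed.

Lemma eventually_imp (E F : seq K -> Prop) : (forall S, E S -> F S) ->
  eventually E -> eventually F.
Proof. by move=> h [S0 h0]; exists S0 => S /h0/h. Qed.

Lemma eventually_ex (E : seq K -> Prop) : eventually E -> exists S, E S.
Proof. by move=> [S h]; exists S; apply: h. Qed.

Lemma eventually_all (I : eqType) (N : seq I) (E : I -> seq K -> Prop) :
  (forall x, x \in N -> eventually (E x)) ->
  eventually (fun S => forall x, x \in N -> E x S).
Proof.
elim: N => [|x N IH] h; first by exists [::].
have hx : eventually (E x) by apply: h; rewrite mem_head.
have hN : eventually (fun S => forall x, x \in N -> E x S).
  by apply: IH => y yN; apply: h; rewrite in_cons yN orbT.
apply: eventually_imp (eventually_and hx hN) => S [h1 h2] y.
by rewrite in_cons => /predU1P[->|/h2].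
Qed.

(** [X] is the power of [Y] modulo the families that are eventually zero. The diagonal is injective
    because an eventual property holds at some list. *)
Lemma reduced_power_ex : exists (X C : lmodType R) (iota : {linear Y -> X})
    (kappa : {linear X -> C}) (q : {linear (seq K -> Y) -> X}),
  [/\ ses iota kappa, surj q, forall f, q f = 0 <-> eventually (fun S => f S = 0) &
      forall c, iota c = q (fun=> c)].
Proof.
have [|X [q [qs qP]]] := @quotient_ex R (seq K -> Y) (fun f => eventually (fun S => f S = 0)).
  split=> [|f g hf hg|r f]; first by exists [::].
    apply: eventually_imp (eventually_and hf hg) => S [e e'].
    by rewrite -[LHS]/(f S - g S) e e' subrr.
  by apply: eventually_imp => S e; rewrite -[LHS]/(r *: f S) e scaler0.
have [iota iotaE] : exists f : {linear Y -> X}, f =1 (fun c => q (fun=> c)).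
  by apply: linear_ex => r x y; rewrite -linearP.
have ii : injective iota.
  by apply: lin_inj => c; rewrite iotaE => /qP /eventually_ex [].
have [C [kappa kP]] := coker_ses ii.
by exists X, C, iota, kappa, q.
Qed.

Variables (X C : lmodType R) (iota : {linear Y -> X}) (kappa : {linear X -> C}).
Variable q : {linear (seq K -> Y) -> X}.
Hypotheses (iota_ses : ses iota kappa) (qs : surj q).
Hypothesis qP : forall f, q f = 0 <-> eventually (fun S => f S = 0).
Hypothesis iotaE : forall c, iota c = q (fun=> c).

Lemma q_eq f g : q f = q g <-> eventually (fun S => f S = g S).
Proof.
split=> [e|e].
  have /qP : q (f - g) = 0 by rewrite linearB e subrr.
  by apply: eventually_imp => S /eqP; rewrite -[X in X == _]/(f S - g S) subr_eq0 => /eqP.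
apply/eqP; rewrite -subr_eq0 -linearB; apply/eqP/qP.
by apply: eventually_imp e => S e; rewrite -[LHS]/(f S - g S) e subrr.
Qed.

(** Finitely many equations that hold in the reduced power hold simultaneously at some coordinate
    [S]; the solution in [Y] is read off there. *)
Lemma reduced_power_pure : pure iota.
Proof.
move=> I B N L z c h; have [zh zE] := choice (fun b => qs (z b)).
have ev : eventually (fun S => forall x, x \in N -> comb (L x) zh S = c x).
  apply: eventually_all => x xN; apply/q_eq; rewrite -iotaE -h // linear_comb.
  by apply: eq_comb => u _; rewrite zE.
have [S hS] := eventually_ex ev; exists (fun b => zh b S) => x /hS <-.
rewrite /comb; elim: (L x) => [|u l IH]; first by rewrite !big_nil.
by rewrite !big_cons IH.
Qed.

End ReducedPower.

(** * Transfer of local solvability and the pure coresolution *)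

Section Transfer.
Variable R : pzRingType.
Variables (M P : nat -> lmodType R).
Variables (i : forall j, {linear M j -> P j}) (p : forall j, {linear P j -> M j.+1}).
Hypothesis P_proj : forall j, projective_module (P j).
Hypothesis ip_ses : forall j, ses (i j) (p j).

Variable d : forall j, {linear P j -> P j.+1}.
Hypothesis dE : forall j x, d j x = i j.+1 (p j x).

Variable T : forall j, seq (P j) -> seq (M j).

(* [T] is independent of the module [Y]: this uniformity is what makes the property pass to
   reduced powers and their pure quotients *)
Definition locally_solvable (Y : lmodType R) : Prop :=
  forall j (S : seq (P j)) (y : {linear P j -> Y}), (forall t, t \in T S -> y (i j t) = 0) ->
    exists w : {linear P j.+1 -> Y}, forall s, s \in S -> y s = w (d j s).

(** On the finite set [y(S)] a dual basis of [Q] reduces to finitely many functionals. Each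
    composite with [y] is solved over [R], always with the same [T S]. *)
Lemma locally_solvable_proj Q : locally_solvable R^o -> projective_module Q ->
  locally_solvable Q.
Proof.
move=> solR hQ j S y yT; have [U [phi phiE]] := dual_basis_fin [seq y s | s <- S] hQ.
have [|w wE] := choice (fun u => solR j S (phi u \o y) _).
  by move=> u t tT; rewrite /= yT // linear0.
have [w' w'E] : exists w' : {linear P j.+1 -> Q}, w' =1 (fun x => \sum_(u <- U) (w u x : R) *: u).
  apply: linear_ex => r x x'; rewrite scaler_sumr -big_split; apply: eq_bigr => u _.
  by rewrite linearP scalerDl scalerA.
exists w' => s sS; rewrite w'E (phiE (y s)); last exact: map_f.
by apply: eq_bigr => u _; rewrite -wE.
Qed.

Section Step.
Variables (K : eqType) (Y X C : lmodType R) (iota : {linear Y -> X}) (kappa : {linear X -> C}).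
Variable q : {linear (seq K -> Y) -> X}.
Hypotheses (iota_ses : ses iota kappa) (qs : surj q).
Hypothesis qP : forall f, q f = 0 <-> eventually (fun S => f S = 0).
Hypothesis iotaE : forall c, iota c = q (fun=> c).
Hypothesis solY : locally_solvable Y.

Let ev_ex (S : seq K) : exists f : {linear (seq K -> Y) -> Y}, f =1 (fun f => f S).
Proof. exact: linear_ex. Qed.

Let ev (S : seq K) : {linear (seq K -> Y) -> Y} := projT1 (cid (ev_ex S)).

Let evE (S : seq K) f : ev S f = f S.
Proof. exact: (projT2 (cid (ev_ex S)) f). Qed.

Let family (A : lmodType R) (w : seq K -> {linear A -> Y}) :
  exists f : {linear A -> X}, f =1 (fun x => q (fun S => w S x)).
Proof.
apply: linear_ex => r x y; rewrite -linearP; congr (q _).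
by apply/funext => S; rewrite linearP.
Qed.

(** As [T S] is finite, almost all coordinates of [y] vanish on it at once. These are solved
    separately in [Y], and the remaining ones get the zero map. *)
Let sol_lift j (S : seq (P j)) (y : {linear P j -> (seq K -> Y)}) :
  (forall t, t \in T S -> q (y (i j t)) = 0) ->
  exists w : {linear P j.+1 -> X}, forall s, s \in S -> q (y s) = w (d j s).
Proof.
move=> yT.
have hev : eventually (fun l => forall t, t \in T S -> y (i j t) l = 0).
  by apply: eventually_all => t /yT /qP.
pose good l (w : {linear P j.+1 -> Y}) := forall s, s \in S -> y s l = w (d j s).
have [w wE] : exists w : seq K -> {linear P j.+1 -> Y}, forall l,
    (forall t, t \in T S -> y (i j t) l = 0) -> good l (w l).
  apply: (@ex_choice _ _ (fun l (w : {linear P j.+1 -> Y}) =>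
     (forall t, t \in T S -> y (i j t) l = 0) -> good l w)) => l.
  have [h|h] := pselect (forall t, t \in T S -> y (i j t) l = 0); last by exists \0.
  have [|w wE] := solY (S := S) (y := ev l \o y); first by move=> t /h; rewrite /= evE.
  by exists w => _ s /wE; rewrite /= evE.
have [w' w'E] := family w; exists w' => s sS; rewrite w'E.
by apply/(q_eq qP); apply: eventually_imp hev => l /wE; apply.
Qed.

Lemma reduced_power_solvable : locally_solvable X.
Proof.
move=> j S y yT; have [yh yE] := P_proj y qs.
have [|w wE] := @sol_lift j S yh; first by move=> t /yT; rewrite yE.
by exists w => s /wE; rewrite yE.
Qed.

(** Lift [y] to [y1] with values in [X]. On [T S] it takes values in the diagonal, and some
    coordinate [l] of a further lift takes exactly these values. Subtracting that coordinate,
    embedded diagonally, makes [y1] vanish on [T S] without changing its image in [C]. *)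
Lemma cokernel_solvable : locally_solvable C.
Proof.
have [ii ks ikE] := iota_ses.
move=> j S y yT; have [y1 y1E] := P_proj y ks; have [yh yhE] := P_proj y1 qs.
have [c cE] : exists c : M j -> Y, forall t, t \in T S -> y1 (i j t) = iota (c t).
  apply: (@ex_choice _ _ (fun t c => t \in T S -> y1 (i j t) = iota c)) => t.
  have [/yT|//] := boolP (t \in T S); last by exists 0.
  by rewrite -y1E => /ikE [c <-]; exists c.
have hev : eventually (fun l => forall t, t \in T S -> yh (i j t) l = c t).
  by apply: eventually_all => t tT; apply/(q_eq qP); rewrite yhE cE.
have [l lE] := eventually_ex hev; pose y2 : {linear P j -> Y} := ev l \o yh.
have [|w wE] := reduced_power_solvable (S := S) (y := y1 \- (iota \o y2)).
  by move=> t tT; rewrite /= evE lE // cE // subrr.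
exists (kappa \o w) => s sS; rewrite /= -wE //= linearB /= y1E.
by rewrite (ses0 _ iota_ses) subr0.
Qed.

End Step.

(** On each finite subset of [P j], the cocycle [f] agrees with a map that factors through [d j].
    The family of these maps defines [g], and for each [x] the required equation holds at all lists
    containing [x]. *)
Lemma reduced_power_step j (Y : lmodType R) (f : {linear P j -> Y}) :
  locally_solvable Y -> (forall x, f (i j x) = 0) ->
  exists (X C : lmodType R) (iota : {linear Y -> X}) (kappa : {linear X -> C})
    (g : {linear P j.+1 -> X}),
  [/\ ses iota kappa, pure iota, locally_solvable C & forall x, g (d j x) = iota (f x)].
Proof.
move=> solY f0.
have [X [C [iota [kappa [q [h1 h2 h3 h4]]]]]] := reduced_power_ex Y (P j).
have [w wE] : exists w : seq (P j) -> {linear P j.+1 -> Y}, forall S s,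
    s \in S -> f s = w S (d j s).
  apply: (@ex_choice _ _ (fun S (w : {linear P j.+1 -> Y}) => forall s, s \in S -> f s = w (d j s))) => S.
  by apply: solY => t _; exact: f0.
have [g gE] : exists g : {linear P j.+1 -> X}, g =1 (fun x => q (fun S => w S x)).
  apply: linear_ex => r x y; rewrite -linearP; congr (q _).
  by apply/funext => S; rewrite linearP.
exists X, C, iota, kappa, g; split=> //.
- exact: reduced_power_pure h2 h3 h4.
- exact: (cokernel_solvable h1 h2 h3 h4 solY).
- move=> x; rewrite gE h4; apply/(q_eq h3); exists [:: x] => S sub.
  by rewrite -wE //; apply: sub; rewrite mem_head.
Qed.

(** The state of the recursion: a map [stg] from [P j], and a quotient [stC] in which it becomes a
    cocycle and which is again locally solvable. *)
Record stage j := Stage {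
  stX : lmodType R; stC : lmodType R; stpi : {linear stX -> stC};
  stg : {linear P j -> stX}; stsol : locally_solvable stC;
  stgi : forall x, stpi (stg (i j x)) = 0 }.

Definition next_stage j (s : stage j) (s' : stage j.+1) : Prop :=
  exists iota : {linear stC s -> stX s'},
  [/\ ses iota (stpi s'), pure iota & forall x, stg s' (d j x) = iota (stpi s (stg s x))].

Lemma next_stage_ex j (s : stage j) : exists s', next_stage s s'.
Proof.
have [X [C [iota [kappa [g [h1 h2 h3 h4]]]]]] :=
  reduced_power_step (f := stpi s \o stg s) (@stsol _ s) (@stgi _ s).
have g0 x : kappa (g (i j.+1 x)) = 0.
  by have [_ ps _] := ip_ses j; have [y <-] := ps x; rewrite -dE h4 /= (ses0 _ h1).
by exists (@Stage j.+1 X C kappa g h3 g0), iota.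
Qed.

(** The recursion starts with both modules equal to [Y], so [pi 0] is an isomorphism; [e] records
    the identification of [X 0] with [Y]. *)
Lemma pure_coresolution (Y : lmodType R) (f : {linear P 0 -> Y}) :
  locally_solvable Y -> (forall x, f (i 0 x) = 0) ->
  exists (X C : nat -> lmodType R) (pi : forall j, {linear X j -> C j})
    (iota : forall j, {linear C j -> X j.+1}) (g : forall j, {linear P j -> X j})
    (e : {linear X 0 -> Y}),
  [/\ injective (pi 0) /\ surj (pi 0), forall j, ses (iota j) (pi j.+1),
      forall j, pure (iota j), forall j x, g j.+1 (d j x) = iota j (pi j (g j x)) &
      forall x, e (g 0 x) = f x].
Proof.
move=> solY f0; pose s0 := @Stage 0 Y Y idfun f solY f0.
have nx j (s : stage j) := cid (next_stage_ex s).
pose st := fix st n : stage n := if n is m.+1 then projT1 (nx m (st m)) else s0.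
have stP j : next_stage (st j) (st j.+1) by rewrite /=; case: (nx j (st j)).
pose iota j := projT1 (cid (stP j)).
have iotaP j := projT2 (cid (stP j)).
exists (fun j => stX (st j)), (fun j => stC (st j)), (fun j => stpi (st j)), iota.
exists (fun j => stg (st j)), idfun; split=> //.
- by split=> // y; exists y.
- by move=> j; have [] := iotaP j.
- by move=> j; have [] := iotaP j.
- by move=> j; have [] := iotaP j.
Qed.

End Transfer.

(** * Null-homotopies *)

Section FiniteHomotopy.
Variable R : pzRingType.
Variables (X C : nat -> lmodType R) (pi : forall j, {linear X j -> C j}).
Variable iota : forall j, {linear C j -> X j.+1}.
Hypotheses (pi0i : injective (pi 0)) (pi0s : surj (pi 0)).
Hypothesis iota_ses : forall j, ses (iota j) (pi j.+1).
Hypothesis iota_pure : forall j, pure (iota j).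

Let pis j : surj (pi j).
Proof. by case: j => // j; have [] := iota_ses j. Qed.

(** Arbitrary lifts satisfy the relations up to errors in the image of the preceding [iota], and
    purity corrects them. In degree zero [pi 0] is injective, so there is no error. *)
Lemma pure_lift j (I B : eqType) (N : seq I) (L : I -> seq (R * B)) (c : B -> C j) :
  (forall x, x \in N -> comb (L x) c = 0) ->
  exists2 u : B -> X j, (forall y, pi j (u y) = c y) &
    forall x, x \in N -> comb (L x) u = 0.
Proof.
move=> c0; have [u0 u0E] := choice (fun y => pis (c y)).
have pu0 x : x \in N -> pi j (comb (L x) u0) = 0.
  by move=> /c0 <-; rewrite linear_comb; apply: eq_comb => u _; rewrite u0E.
case: j c c0 u0 u0E pu0 => [|j] c c0 u0 u0E pu0.
  by exists u0 => // x /pu0 e; apply: pi0i; rewrite e linear0.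
have [_ _ ex] := iota_ses j.
have [b bE] : exists b : I -> C j, forall x, x \in N -> comb (L x) u0 = iota j (b x).
  apply: (@ex_choice _ _ (fun x b => x \in N -> comb (L x) u0 = iota j b)) => x.
  have [/pu0/ex[b <-]|_] := boolP (x \in N); last by exists 0.
  by exists b.
have [z zE] := iota_pure bE.
exists (fun y => u0 y - iota j (z y)) => [y|x xN].
  by rewrite linearB u0E (ses0 _ (iota_ses j)) subr0.
by rewrite combB -linear_comb zE // bE // subrr.
Qed.

(** [L x] is the differential of the generator [x], written in generators of the next degree. [N] is
    a part closed under it that is finite in each degree. *)
Variables (B : nat -> eqType) (L : forall j, B j -> seq (R * B j.+1)).
Variables (g : forall j, B j -> X j) (N : forall j, seq (B j)).
Arguments L {j}.
Hypothesis N_closed : forall j (x : B j) u, x \in N j -> u \in L x -> u.2 \in N j.+1.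
Hypothesis combK : forall j (V : lmodType R) (t : B j.+2 -> V) x, x \in N j ->
  comb (L x) (fun y => comb (L y) t) = 0.
Hypothesis g_chain : forall j x, x \in N j ->
  iota j (pi j (g x)) = comb (L x) (@g j.+1).

Let delta j (x : X j) : X j.+1 := iota j (pi j x).

Let delta_comb j (I : eqType) (l : seq (R * I)) (t : I -> X j) :
  delta (comb l t) = comb l (fun y => delta (t y)).
Proof. by rewrite /delta !linear_comb. Qed.

Let deltaB j (x y : X j) : delta (x - y) = delta x - delta y.
Proof. by rewrite /delta !linearB. Qed.

Let deltaK j (x : X j) : delta (delta x) = 0.
Proof. by rewrite /delta (ses0 _ (iota_ses j)) linear0. Qed.

(** The partial homotopy [h] leaves an error [g - delta h] that vanishes on the differentials of
    generators in [N j]; this is what permits the next step. *)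
Let inv j (h : B j.+1 -> X j) : Prop :=
  forall x, x \in N j -> comb (L x) (fun y => g y - delta (h y)) = 0.

Let start : exists h : B 1 -> X 0,
  inv h /\ forall x, x \in N 0 -> g x = comb (L x) h.
Proof.
have [z zE] := iota_pure (fun x xN => esym (@g_chain 0 x xN)).
have [h hE] := choice (fun y => pis (z y)); exists h.
have gE x : x \in N 0 -> g x = comb (L x) h.
  move=> xN; apply: pi0i; rewrite linear_comb -zE //.
  by apply: eq_comb => u _; rewrite hE.
by split=> // x xN; rewrite combB -g_chain // -delta_comb -gE // subrr.
Qed.

(** Purity in the next degree gives [h'] such that the error [v] of [h] and [h'] lies in the image
    of [iota j]. By the invariant its preimage satisfies the relations from [N j], so it lifts to
    [u] satisfying them too. Replacing [h] by [h + u] removes the error and preserves the equation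
    one degree lower. *)
Let step j (h : B j.+1 -> X j) : inv h ->
  exists (u : B j.+1 -> X j) (h' : B j.+2 -> X j.+1),
  [/\ forall x, x \in N j -> comb (L x) u = 0,
      forall x, x \in N j.+1 -> g x = delta (h x + u x) + comb (L x) h' & inv h'].
Proof.
move=> hh; pose e y := g y - delta (h y).
have [|z zE] := @iota_pure j.+1 _ _ (N j.+1) (@L j.+1) (@g j.+2) (fun x => pi j.+1 (e x)).
  move=> x xN; rewrite -g_chain //; congr (iota _ _).
  by rewrite /e linearB /delta (ses0 _ (iota_ses j)) subr0.
have [h' h'E] := choice (fun y => pis (z y)).
(* The error is known to come from [C j] only on [N j.+1]; the value zero elsewhere lets [c] be
   chosen for all [y]. *)
pose v y := if y \in N j.+1 then e y - comb (L y) h' else 0.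
have [ii _ ex] := iota_ses j.
have vC y : image_of (iota j) (v y).
  apply/ex; rewrite /v; case: ifP => [yN|_]; last exact: linear0.
  rewrite linearB linear_comb -zE //; apply/eqP; rewrite subr_eq0; apply/eqP.
  by apply: eq_comb => u _; rewrite h'E.
have [c cE] := choice vC.
have [|u uE u0] := @pure_lift j _ _ (N j) (@L j) c.
  move=> x xN; apply: (inj_lin0 ii); rewrite linear_comb.
  rewrite (eq_comb (t' := fun y => e y - comb (L y) h')) => [|w wL].
    by rewrite combB combK // subr0 hh.
  by rewrite cE /v (N_closed xN wL).
have gE x : x \in N j.+1 -> g x = delta (h x + u x) + comb (L x) h'.
  move=> xN; rewrite {1}/delta linearD uE linearD cE /v xN /e.
  by rewrite -addrA subrK addrC subrK.
exists u, h'; split=> // x xN; rewrite combB -g_chain // -delta_comb.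
rewrite -[X in X - _]/(delta (g x)) -deltaB.
by rewrite [X in delta (X - _)]gE // addrK deltaK.
Qed.

Lemma finite_homotopy : exists t : forall j, B j.+1 -> X j,
  (forall x, x \in N 0 -> g x = comb (L x) (t 0)) /\
  forall j x, x \in N j.+1 ->
    g x = comb (L x) (t j.+1) + iota j (pi j (t j x)).
Proof.
have [h0 [h0i h0E]] := cid start.
have st j (s : {h : B j.+1 -> X j | inv h}) :
    {s' : {h : B j.+2 -> X j.+1 | inv h} & {u : B j.+1 -> X j |
    (forall x, x \in N j -> comb (L x) u = 0) /\
    (forall x, x \in N j.+1 -> g x = delta (sval s x + u x) + comb (L x) (sval s'))}}.
  have /cid[u /cid[h' [u0 gE h'i]]] := step (svalP s).
  by exists (exist _ h' h'i), u.
pose s := fix s j : {h : B j.+1 -> X j | inv h} :=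
  if j is k.+1 then projT1 (st k (s k)) else exist _ h0 h0i.
pose u j := sval (projT2 (st j (s j))); have uP j := svalP (projT2 (st j (s j))).
(* The correction [u j] is invisible to the equation in degree [j], so the corrected maps satisfy
   all equations together. *)
have combD j x : x \in N j -> comb (L x) (fun y => sval (s j) y + u j y) = comb (L x) (sval (s j)).
  move=> xN; have [u0 _] := uP j.
  have := combB (L x) (fun y => sval (s j) y + u j y) (u j); rewrite u0 // subr0 => <-.
  by apply: eq_comb => w _; rewrite addrK.
exists (fun j y => sval (s j) y + u j y); split=> [x xN|j x xN].
  by rewrite combD // h0E.
by rewrite (combD j.+1) // addrC; have [_ gE] := uP j; exact: gE.
Qed.

End FiniteHomotopy.

Section Homotopy.
Variable R : pzRingType.
Variables (X C : nat -> lmodType R) (pi : forall j, {linear X j -> C j}).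
Variable iota : forall j, {linear C j -> X j.+1}.
Hypotheses (pi0i : injective (pi 0)) (pi0s : surj (pi 0)).
Hypothesis iota_ses : forall j, ses (iota j) (pi j.+1).
Hypothesis iota_pure : forall j, pure (iota j).
Variables (B : nat -> eqType) (L : forall j, B j -> seq (R * B j.+1)).
Variable (g : forall j, B j -> X j).
Arguments L {j}.
Hypothesis combK : forall j (V : lmodType R) (t : B j.+2 -> V) x,
  comb (L x) (fun y => comb (L y) t) = 0.
Hypothesis g_chain : forall j x, iota j (pi j (g x)) = comb (L x) (@g j.+1).

Let delta j (x : X j) : X j.+1 := iota j (pi j x).

(** A null-homotopy on the subcomplex generated by [dom]; the values of [hom] matter only on
    [dom]. *)
Record partial := Partial {
  dom : forall j, B j -> Prop; hom : forall j, B j.+1 -> X j;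
  dom_closed : forall j (x : B j) u, dom x -> u \in L x -> dom u.2;
  hom0 : forall x : B 0, dom x -> g x = comb (L x) (@hom 0);
  homS : forall j (x : B j.+1), dom x ->
    g x = comb (L x) (@hom j.+1) + delta (@hom j x) }.

Let extends (a b : partial) : bool :=
  `[< (forall j x, dom a x -> @dom b j x) /\
      forall j x, @dom a j.+1 x -> hom a x = hom b x >].

Let empty : partial.
Proof. by refine (@Partial (fun _ _ => False) (fun _ _ => 0) _ _ _). Qed.

Let chain_bound (A : set partial) : total_on A extends ->
  exists t, forall s, A s -> extends s t.
Proof.
move=> Atot; pose D j (x : B j) := exists2 a, A a & dom a x.
have hP j (x : B j.+1) : exists y, forall a, A a -> dom a x -> hom a x = y.
  have [[a Aa ax]|nD] := pselect (D _ x); last by exists 0 => a Aa ax; case: nD; exists a.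
  exists (hom a x) => b Ab bx.
  by have [/asboolP[_ e]|/asboolP[_ e]] := Atot _ _ Aa Ab; rewrite e.
pose h j x := projT1 (cid (hP j x)).
have hE a j (x : B j.+1) : A a -> dom a x -> h _ x = hom a x.
  by move=> Aa ax; rewrite /h -(projT2 (cid (hP j x)) a Aa ax).
unshelve refine (ex_intro _ (@Partial D h _ _ _) _).
- by move=> j x u [a Aa ax] uL; exists a => //; exact: dom_closed ax uL.
- move=> x [a Aa ax]; rewrite (hom0 ax); apply: eq_comb => u uL.
  by rewrite (hE a) //; exact: dom_closed ax uL.
- move=> j x [a Aa ax]; rewrite (homS ax) (hE a) //; congr (_ + _).
  by apply: eq_comb => u uL; rewrite (hE a) //; exact: dom_closed ax uL.
- move=> a Aa; apply/asboolP; split=> [j x ax|j x ax] /=; first by exists a.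
  by rewrite (hE a).
Qed.

(** Since each [L x] is finite, one generator spans a closed part that is finite in every degree,
    although it may meet infinitely many degrees. *)
Let closure k (e : B k) : exists c : forall j, seq (B j),
  e \in c k /\ forall j (x : B j) u, x \in c j -> u \in L x -> u.2 \in c j.+1.
Proof.
(* [E] is the singleton of [e] in degree [k] and empty elsewhere; the cast moves [e] along
   [k = j]. *)
pose E j : seq (B j) := if pselect (k = j) is left h then [:: ecast j (B j) h e] else [::].
pose c := fix c j : seq (B j) := if j is l.+1 then
  E l.+1 ++ flatten [seq [seq u.2 | u <- L x] | x <- c l] else E 0.
exists c; split.
  have eE : e \in E k by rewrite /E; case: pselect => // h; rewrite eq_axiomK mem_head.
  have EC j x : x \in E j -> x \in c j by case: j x => [|j] x //= xE; rewrite mem_cat xE.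
  exact: EC.
move=> j x u xc uL; rewrite /= mem_cat; apply/orP; right; apply/flattenP.
exists [seq u.2 | u <- L x]; last exact: map_f.
exact: (map_f (fun x => [seq u.2 | u <- L x])).
Qed.

(** The given homotopy, extended by zero to [s], is subtracted from [g]. What remains is treated
    modulo the generators in [dom a]: [N] and [LN] discard these, [finite_homotopy] applies, and its
    result is glued to the old homotopy. *)
Let extension (a : partial) k (e : B k) : exists b, extends a b /\ dom b e.
Proof.
have [c [ec cL]] := closure e.
pose out j (y : B j) := ~~ `[< dom a y >].
have outP j (y : B j) : ~~ out _ y -> dom a y by rewrite negbK => /asboolP.
pose N j := [seq x <- c j | out _ x].
pose LN j (x : B j) := [seq u <- L x | out _ u.2].
pose s j (y : B j.+1) : X j := if out _ y then 0 else hom a y.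
pose g' j : B j -> X j := fun y => g y - comb (L y) (s j).
have LNE j (x : B j) (V : lmodType R) (t : B j.+1 -> V) :
    comb (LN _ x) t = comb (L x) (fun y => if out _ y then t y else 0).
  rewrite -[RHS](@comb_filter R _ V (out j.+1)) => [|y /negPf -> //].
  by apply: eq_comb => u; rewrite mem_filter => /andP[-> _].
have domL j (x : B j) u : ~~ out _ x -> u \in L x -> out _ u.2 = false.
  by move=> /outP ax uL; apply/negbTE; rewrite negbK; apply/asboolP; exact: dom_closed ax uL.
have gs0 (x : B 0) : ~~ out _ x -> g x = comb (L x) (s 0%N).
  move=> xo; rewrite (hom0 (outP _ _ xo)); apply: eq_comb => u uL.
  by rewrite /s (domL _ _ _ xo uL).
have gsS j (x : B j.+1) : ~~ out _ x -> g' _ x = delta (s _ x).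
  move=> xo; rewrite /g' (homS (outP _ _ xo)) /s (negPf xo).
  rewrite (eq_comb (t' := @hom a j.+1)) => [|u uL]; last by rewrite (domL _ _ _ xo uL).
  by rewrite addrAC subrr add0r.
have [|||t [t0 tS]] := @finite_homotopy R X C pi iota pi0i pi0s iota_ses iota_pure B LN g' N.
- move=> j x u; rewrite !mem_filter => /andP[_ xc] /andP[-> uL].
  exact: cL xc uL.
- move=> j V t x _; rewrite LNE.
  rewrite (eq_comb (t' := fun y => comb (L y) (fun z => if out _ z then t z else 0))) => [|u _].
    exact: combK.
  case: ifPn => uo; first exact: LNE.
  apply/esym; rewrite -[RHS](comb_null _ (L u.2)); apply: eq_comb => w wL.
  by rewrite (domL _ _ _ uo wL).
(* Inside [dom a] the modified map [g'] equals [delta s], so the terms discarded from [L x] cancel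
   against the differential of [s]. *)
- move=> j x _; rewrite LNE /g' !linearB g_chain [pi _ (comb _ _)]linear_comb [iota _ (comb _ _)]linear_comb.
  rewrite -[LHS]subr0 -[X in _ - X = _](combK (s j.+1) x) addrAC -combB -combB.
  apply: eq_comb => u uL; case: ifPn => uo; first by rewrite {2}/s uo !linear0 addr0.
  by have := gsS _ _ uo; rewrite /g' /delta => ->; rewrite subrr.
pose s' j (y : B j.+1) : X j := if out _ y then t j y else hom a y.
have s'E j (x : B j) : comb (L x) (s' j) = comb (L x) (s j) + comb (LN _ x) (t j).
  rewrite LNE; apply/eqP; rewrite addrC -subr_eq -combB; apply/eqP.
  apply: eq_comb => u _; rewrite /s' /s; case: ifP => _; rewrite ?subr0 ?subrr //.
unshelve refine (ex_intro _ (@Partial (fun j x => dom a x \/ x \in c j) s' _ _ _) _).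
- move=> j x u [ax|xc] uL; first by left; exact: dom_closed ax uL.
  by right; exact: cL xc uL.
- move=> x xd; have [xo|xo] := boolP (out _ x).
    have xN : x \in N 0 by rewrite mem_filter xo; case: xd => // ax; case/asboolP: xo.
    by rewrite s'E -t0 // addrC subrK.
  rewrite (gs0 _ xo); apply: eq_comb => u uL.
  by rewrite /s /s' (domL _ _ _ xo uL).
- move=> j x xd; have [xo|xo] := boolP (out _ x).
    have xN : x \in N j.+1 by rewrite mem_filter xo; case: xd => // ax; case/asboolP: xo.
    by rewrite s'E -addrA /delta /s' xo -tS // addrC subrK.
  have := gsS _ _ xo; rewrite /g' /s /s' (negPf xo) => /eqP; rewrite subr_eq addrC => /eqP ->.
  congr (_ + _); apply: eq_comb => u uL.
  by rewrite (domL _ _ _ xo uL).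
split; last by right.
apply/asboolP; split=> [j x ax|j x ax] /=; first by left.
by rewrite /s' /out; case: asboolP.
Qed.

(** A maximal partial homotopy is defined on every generator by [extension]; only its degree-zero
    equation is retained. *)
Lemma homotopy_ex : exists h : B 1 -> X 0, forall x : B 0, g x = comb (L x) h.
Proof.
have [||m mmax] := @ZL_preorder partial empty extends _ _ chain_bound.
- by move=> a; apply/asboolP; split.
- move=> b a c /asboolP[h1 h2] /asboolP[h3 h4]; apply/asboolP; split=> [j x /h1/h3 //|j x ax].
  by rewrite h2 // h4 //; exact: h1.
exists (@hom m 0) => x; apply: hom0.
have [b [ab bx]] := extension m x.
by have /asboolP[h _] := mmax b ab; exact: h.
Qed.

End Homotopy.

(** * Classes of coresolved modules *)

Definition linked (R : pzRingType) (K C : lmodType R) : Prop :=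
  exists (P : lmodType R) (i : {linear K -> P}) (p : {linear P -> C}),
    projective_module P /\ ses i p.

(* [Phi i] stands for the vanishing of [Tor_1] or [Ext^1] of the cokernel of the monomorphism [i]
   against a class of test modules *)
Record mono_class (R : pzRingType) (Phi : forall K A : lmodType R, {linear K -> A} -> Prop) :=
  MonoClass {
  mc_comp : forall (K A B : lmodType R) (i : {linear K -> A}) (j : {linear A -> B})
    (h : {linear K -> B}), (forall x, h x = j (i x)) -> Phi _ _ i -> Phi _ _ j -> Phi _ _ h;
  mc_cancel : forall (K A B : lmodType R) (i : {linear K -> A}) (j : {linear A -> B})
    (h : {linear K -> B}), (forall x, h x = j (i x)) -> Phi _ _ h -> Phi _ _ i;
  mc_id : forall (K : lmodType R) (i : {linear K -> K}), (forall x, i x = x) -> Phi _ _ i;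
  mc_pushout : forall (K P K' A : lmodType R) (i : {linear K -> P}) (c : {linear K -> K'})
    (i' : {linear K' -> A}) (b : {linear P -> A}), (forall x, b (i x) = i' (c x)) ->
    (forall a, exists x k, a = b x + i' k) ->
    (forall x k, b x = i' k -> exists2 z, i z = x & c z = k) ->
    Phi _ _ i -> Phi _ _ i' }.

Definition tor_mono (R : pzRingType) (K A : lmodType R) (i : {linear K -> A}) : Prop :=
  forall E : lmodType R^c, injective_module E -> forall w : tensor E K,
    tensor_map i w = 0 -> w = 0.

Definition ext_mono (R : pzRingType) (L K A : lmodType R) (i : {linear K -> A}) : Prop :=
  forall f : {linear K -> L}, exists g : {linear A -> L}, forall x, g (i x) = f x.

Definition pext_mono (R : pzRingType) (K A : lmodType R) (i : {linear K -> A}) : Prop :=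
  forall Q, projective_module Q -> ext_mono Q i.

Lemma ext_mono_class (R : pzRingType) (L : lmodType R) : mono_class (@ext_mono R L).
Proof.
split=> [K A B i j h hE Hi Hj f|K A B i j h hE Hh f|K i iE f|K P K' A i c i' b sq gen ex Hi f].
- have [g gE] := Hi f; have [g' g'E] := Hj g.
  by exists g' => x; rewrite hE g'E.
- by have [g gE] := Hh f; exists (g \o j) => x; rewrite -gE hE.
- by exists f => x; rewrite iE.
have [g gE] := Hi (f \o c).
have [s sE] : exists s : {linear (P * K')%type -> A}, s =1 (fun x => b x.1 + i' x.2).
  by apply: linear_ex => r x y; rewrite !linearP scalerDr addrACA.
have [t tE] : exists t : {linear (P * K')%type -> L}, t =1 (fun x => g x.1 + f x.2).
  by apply: linear_ex => r x y; rewrite !linearP scalerDr addrACA.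
have [||h hE] := @factor_surj _ _ _ _ s t.
- by move=> a; have [x [k ->]] := gen a; exists (x, k); rewrite sE.
- move=> [x k]; rewrite sE tE /= => /eqP; rewrite addr_eq0 -linearN => /eqP /ex [z <- e].
  by rewrite gE /= e linearN addNr.
by exists h => k; have := hE (0, k); rewrite sE tE /= !linear0 !add0r.
Qed.

Lemma pext_mono_class (R : pzRingType) : mono_class (@pext_mono R).
Proof.
split=> [K A B i j h hE Hi Hj Q hQ|K A B i j h hE Hh Q hQ|K i iE Q hQ|
  K P K' A i c i' b sq gen ex Hi Q hQ]; have [h1 h2 h3 h4] := ext_mono_class Q.
- by apply: h1 hE _ _; [exact: Hi | exact: Hj].
- by apply: h2 hE _; exact: Hh.
- exact: h3.
- by apply: h4 sq gen ex _; exact: Hi.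
Qed.

(** For the pushout clause, [A] is the cokernel of [u] from [K] to [P * K']. If [i'] kills [w],
    right exactness lifts the copy of [w] in the second factor to [v] over [K]. Projecting to [P]
    shows that [v] is zero, and projecting to [K'] then shows that [w] is. *)
Lemma tor_mono_class (R : pzRingType) : mono_class (@tor_mono R).
Proof.
split=> [K A B i j h hE Hi Hj E hE' w|K A B i j h hE Hh E hE' w w0|K i iE E hE w|
  K P K' A i c i' b sq gen ex Hi E hE w w0].
- by rewrite (tensor_map_comp w hE) => /(Hj E hE')/(Hi E hE').
- apply: (Hh E hE'); rewrite (tensor_map_comp w hE) w0.
  by have [g gE] := tensor_map_additive E j; rewrite -gE raddf0.
- by rewrite tensor_map_id.
have [s sE] : exists s : {linear (P * K')%type -> A}, s =1 (fun x => b x.1 + i' x.2).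
  by apply: linear_ex => r x y; rewrite !linearP scalerDr addrACA.
have [u uE] : exists u : {linear K -> (P * K')%type}, u =1 (fun z => (i z, - c z)).
  by apply: linear_ex => r x y; rewrite !linearP.
have [n nE] : exists n : {linear K' -> (P * K')%type}, n =1 (fun k => (0, k)).
  by apply: linear_ex => r x y; congr pair; rewrite /= scaler0 addr0.
have [p1 p1E] : exists p1 : {linear (P * K')%type -> P}, p1 =1 (fun x => x.1).
  exact: linear_ex.
have [p2 p2E] : exists p2 : {linear (P * K')%type -> K'}, p2 =1 (fun x => x.2).
  exact: linear_ex.
have [|||v vE] := @tensor_right_exact R E _ _ _ u s (tensor_map n w).
- by move=> a; have [x [k ->]] := gen a; exists (x, k); rewrite sE.
- move=> [x k]; rewrite sE /=; split=> [/eqP|[z]].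
    rewrite addr_eq0 -linearN => /eqP /ex [z zx zk]; exists z.
    by rewrite uE zx zk opprK.
  by rewrite uE => -[<- <-]; rewrite sq linearN subrr.
- rewrite -(tensor_map_comp w (h := i')) // => k; by rewrite nE sE /= linear0 add0r.
have v0 : v = 0.
  apply: (Hi E hE); rewrite (tensor_map_comp v (f := u) (g := p1)) ?vE => [|x]; last by rewrite p1E uE.
  rewrite -(tensor_map_comp w (h := (\0 : {linear K' -> P}))) ?tensor_map_null // => k.
  by rewrite nE p1E.
have : tensor_map p2 (tensor_map n w) = w.
  rewrite -(tensor_map_comp w (h := idfun)) ?tensor_map_id // => k.
  by rewrite nE p2E.
rewrite -vE v0 => <-.
have [g1 g1E] := tensor_map_additive E u; have [g2 g2E] := tensor_map_additive E p2.
by rewrite -g1E -g2E !raddf0.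
Qed.

(** * Pullbacks, pushouts and horseshoe lemmas *)

Section SesFacts.
Variable R : pzRingType.
Implicit Types A B C K M N P X Z KA KC PA PC : lmodType R.

(** The square is described by its properties, so that the same pullback can be read along either of
    its two sides. *)
Lemma pullback_ses K A M X Z (i : {linear K -> A}) (p : {linear A -> M}) (f : {linear X -> M})
    (u : {linear Z -> A}) (v : {linear Z -> X}) :
  (forall z, p (u z) = f (v z)) ->
  (forall a x, p a = f x -> exists z, u z = a /\ v z = x) ->
  (forall z, u z = 0 -> v z = 0 -> z = 0) ->
  ses i p -> exists k : {linear K -> Z}, ses k v /\ forall x, u (k x) = i x.
Proof.
move=> h1 h2 h3 h; have [ii ps ipE] := h.
have kx x : exists z, u z = i x /\ v z = 0 by apply: h2; rewrite linear0 (ses0 _ h).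
have [k kE] : exists k : {linear K -> Z}, forall x, u (k x) = i x /\ v (k x) = 0.
  apply: (@linear_graph _ _ _ (fun x z => u z = i x /\ v z = 0)) => //.
    move=> x z z' [e1 e2] [e3 e4]; apply/eqP; rewrite -subr_eq0; apply/eqP/h3.
      by rewrite linearB e1 e3 subrr.
    by rewrite linearB e2 e4 subrr.
  by move=> r x x' z z' [e1 e2] [e3 e4]; rewrite !linearP e1 e2 e3 e4 scaler0 addr0.
exists k; split=> [|x]; last by case: (kE x).
split.
- apply: lin_inj => x e; apply: (inj_lin0 ii).
  by have [<- _] := kE x; rewrite e linear0.
- by move=> x; have [a ax] := ps (f x); have [z [_ <-]] := h2 _ _ ax; exists z.
- move=> z; split=> [vz|[x <-]]; last by case: (kE x).
  have /ipE[x xE] : p (u z) = 0 by rewrite h1 vz linear0.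
  exists x; apply/eqP; rewrite -subr_eq0; apply/eqP/h3; rewrite linearB.
    by have [-> _] := kE x; rewrite xE subrr.
  by have [_ ->] := kE x; rewrite vz subrr.
Qed.

Lemma ses_pullback K A M X (i : {linear K -> A}) (p : {linear A -> M}) (f : {linear X -> M}) :
  ses i p -> exists (Z : lmodType R) (u : {linear Z -> A}) (v : {linear Z -> X}) (k : {linear K -> Z}),
  [/\ ses k v, forall z, p (u z) = f (v z), forall x, u (k x) = i x &
      forall a x, p a = f x -> exists z, u z = a /\ v z = x].
Proof.
move=> h; have [Z [u [v [h1 h2 h3]]]] := pullback_ex p f.
have [k [hk kE]] := pullback_ses h1 h2 h3 h.
by exists Z, u, v, k.
Qed.

Lemma pushout_ses K A M B Z (i : {linear K -> A}) (p : {linear A -> M}) (f : {linear K -> B})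
    (u : {linear A -> Z}) (v : {linear B -> Z}) :
  (forall x, u (i x) = v (f x)) ->
  (forall a b, u a = v b -> exists x, i x = a /\ f x = b) ->
  (forall z, exists a b, z = u a + v b) ->
  ses i p -> exists t : {linear Z -> M}, ses v t.
Proof.
move=> h1 h2 h3 h; have [ii ps ipE] := h.
have tfun a b a' b' : u a + v b = u a' + v b' -> p a = p a'.
  move=> e; have [|x [xE _]] := h2 (a - a') (b' - b).
    by apply/eqP; rewrite !linearB subr_eq addrAC eq_sym subr_eq e addrC.
  by apply/eqP; rewrite -subr_eq0 -linearB -xE (ses0 _ h).
have [t tE] : exists t : {linear Z -> M}, forall z, exists a b, z = u a + v b /\ t z = p a.
  apply: (@linear_graph _ _ _ (fun z m => exists a b, z = u a + v b /\ m = p a)).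
  - by move=> z; have [a [b ->]] := h3 z; exists (p a), a, b.
  - by move=> _ _ _ [a [b [-> ->]]] [a' [b' [/tfun -> ->]]].
  - move=> r _ _ _ _ [a [b [-> ->]]] [a' [b' [-> ->]]]; exists (r *: a + a'), (r *: b + b').
    by rewrite !linearP scalerDr addrACA.
have tu a b : t (u a + v b) = p a.
  by have [a' [b' [e ->]]] := tE (u a + v b); rewrite (tfun _ _ _ _ e).
have tv b : t (v b) = 0 by have := tu 0 b; rewrite !linear0 add0r.
exists t; split.
- apply: lin_inj => b e; have [|x [xE <-]] := h2 0 b; first by rewrite linear0 e.
  by rewrite (inj_lin0 ii xE) linear0.
- by move=> m; have [a <-] := ps m; exists (u a); have := tu a 0; rewrite linear0 addr0.
- move=> z; split=> [|[b <-]]; last exact: tv.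
  have [a [b ->]] := h3 z; rewrite tu => /ipE[x <-].
  by exists (f x + b); rewrite h1 linearD.
Qed.

Lemma ses_split_proj K A P (i : {linear K -> A}) (p : {linear A -> P}) :
  projective_module P -> ses i p ->
  exists r : {linear A -> K}, forall x, r (i x) = x.
Proof.
move=> hP h; have [ii ps ex] := h; have [s sE] := proj_section hP ps.
have [|r rE] := @factor_inj _ _ _ _ i (idfun \- (s \o p)) ii.
  by move=> a; apply/ex; rewrite linearB /= sE subrr.
by exists r => x; apply: ii; rewrite rE /= (ses0 _ h) linear0 subr0.
Qed.

Lemma ses_kernel_comp K A B X C (i : {linear K -> A}) (p : {linear A -> X})
    (j : {linear B -> X}) (q : {linear X -> C}) : ses i p -> ses j q ->
  exists (Y : lmodType R) (y : {linear Y -> A}) (k : {linear K -> Y}) (t : {linear Y -> B}),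
  [/\ ses y (q \o p), ses k t, forall x, y (k x) = i x & forall z, j (t z) = p (y z)].
Proof.
move=> h h'; have [ii ps ex] := h; have [ji qs ex'] := h'.
have qps : surj (q \o p).
  by move=> c; have [x <-] := qs c; have [a <-] := ps x; exists a.
have [Y [y hy]] := kernel_ses qps; have [yi _ yex] := hy.
have [|k kE] := @factor_inj _ _ _ _ y i yi.
  by move=> x; apply/yex; rewrite /= (ses0 _ h) linear0.
have [|t tE] := @factor_inj _ _ _ _ j (p \o y) ji.
  by move=> z; apply/ex'; exact: (ses0 z hy).
exists Y, y, k, t; split=> //; split.
- by apply: lin_inj => x e; apply: (inj_lin0 ii); rewrite -kE e linear0.
- move=> b; have [a aE] := ps (j b).
  have /yex[z zE] : (q \o p) a = 0 by rewrite /= aE (ses0 _ h').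
  by exists z; apply: ji; rewrite tE /= zE.
- move=> z; split=> [tz|[x <-]].
    have /ex[x xE] : p (y z) = 0 by rewrite -[p _]tE tz linear0.
    by exists x; apply: yi; rewrite kE.
  by apply: ji; rewrite tE /= kE (ses0 _ h) linear0.
Qed.

Lemma ses_coker_comp M X P B C (i : {linear M -> X}) (p : {linear X -> P})
    (j : {linear X -> B}) (q : {linear B -> C}) : ses i p -> ses j q ->
  exists (Y : lmodType R) (y : {linear B -> Y}) (k : {linear P -> Y}) (t : {linear Y -> C}),
  [/\ ses (j \o i) y, ses k t & forall z, t (y z) = q z].
Proof.
move=> h h'; have [ii ps ex] := h; have [ji qs ex'] := h'.
have jii : injective (j \o i) by apply: inj_comp.
have [Y [y hy]] := coker_ses jii; have [_ ys yex] := hy.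
have [|k kE] := @factor_surj _ _ _ _ p (y \o j) ps.
  by move=> x /ex[m <-]; exact: (ses0 m hy).
have [|t tE] := @factor_surj _ _ _ _ y q ys.
  by move=> b /yex[m <-] /=; rewrite (ses0 _ h').
exists Y, y, k, t; split=> //; split.
- apply: lin_inj => x; have [z <-] := ps x; rewrite kE /= => /yex[m] /= /ji <-.
  by rewrite (ses0 _ h).
- by move=> c; have [b <-] := qs c; exists (y b).
- move=> z; have [b <-] := ys z; rewrite tE; split=> [/ex'[x <-]|[x]].
    by exists (p x); rewrite kE.
  have [x' <-] := ps x; rewrite kE /= => /eqP; rewrite eq_sym -subr_eq0 -linearB => /eqP/yex[m] /= mE.
  have -> : b = j (i m + x') by rewrite linearD mE subrK.
  by rewrite (ses0 _ h').
Qed.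

Lemma ses_pair A B : exists (i : {linear A -> (A * B)%type}) (p : {linear (A * B)%type -> B}),
  [/\ ses i p, i =1 (fun a => (a, 0)) & p =1 (fun x => x.2)].
Proof.
have [i iE] : exists i : {linear A -> (A * B)%type}, i =1 (fun a => (a, 0)).
  by apply: linear_ex => r x y; congr pair; rewrite /= scaler0 addr0.
have [p pE] : exists p : {linear (A * B)%type -> B}, p =1 (fun x => x.2).
  exact: linear_ex.
exists i, p; split=> //; split.
- by move=> x y; rewrite !iE => -[].
- by move=> b; exists (0, b); rewrite pE.
- move=> [a b]; rewrite pE; split=> [/= ->|[x]]; first by exists a; rewrite iE.
  by rewrite iE => -[_ <-].
Qed.

Lemma horseshoe A X C KA PA KC PC (i : {linear A -> X}) (p : {linear X -> C})
    (a : {linear KA -> PA}) (a' : {linear PA -> A})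
    (c : {linear KC -> PC}) (c' : {linear PC -> C}) (l : {linear PC -> X}) :
  ses i p -> ses a a' -> ses c c' -> (forall v, p (l v) = c' v) ->
  exists (K : lmodType R) (k : {linear K -> (PA * PC)%type}) (k' : {linear (PA * PC)%type -> X})
    (u : {linear KA -> K}) (v : {linear K -> KC}), ses k k' /\ ses u v.
Proof.
move=> h ha hc lE; have [ii ps ex] := h; have [ai as' aex] := ha; have [ci cs cex] := hc.
have [k' k'E] : exists k' : {linear (PA * PC)%type -> X}, k' =1 (fun x => i (a' x.1) + l x.2).
  by apply: linear_ex => r x y; rewrite !linearP scalerDr addrACA.
have ks : surj k'.
  move=> x; have [v vE] := cs (p x).
  have /ex[z zE] : p (x - l v) = 0 by rewrite linearB lE vE subrr.
  by have [w wE] := as' z; exists (w, v); rewrite k'E /= wE zE subrK.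
have [K [k hk]] := kernel_ses ks; have [ki _ kex] := hk.
have [m mE] : exists m : {linear KA -> (PA * PC)%type}, m =1 (fun x => (a x, 0)).
  by apply: linear_ex => r x y; rewrite linearP; congr pair; rewrite /= scaler0 addr0.
have [|u uE] := @factor_inj _ _ _ _ k m ki.
  by move=> x; apply/kex; rewrite k'E mE /= (ses0 _ ha) !linear0 addr0.
have k2 x : i (a' (k x).1) + l (k x).2 = 0 by rewrite -k'E; apply: ses0 hk.
have [n nE] : exists n : {linear K -> PC}, n =1 (fun x => (k x).2).
  by apply: linear_ex => r x y; rewrite linearP.
have [|v vE] := @factor_inj _ _ _ _ c n ci.
  move=> x; apply/cex; rewrite nE -lE; have := congr1 p (k2 x).
  by rewrite linearD (ses0 _ h) add0r linear0.
exists K, k, k', u, v; split=> //; split.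
- apply: lin_inj => x e; apply: (inj_lin0 ai).
  by have := uE x; rewrite e linear0 mE => -[].
- move=> z; have /ex[w wE] : p (l (c z)) = 0 by rewrite lE (ses0 _ hc).
  have [y yE] := as' (- w).
  have /kex[x xE] : k' (y, c z) = 0 by rewrite k'E /= yE linearN wE addNr.
  by exists x; apply: ci; rewrite vE nE xE.
- move=> x; split=> [vx|[y <-]]; last by apply: ci; rewrite vE nE uE mE linear0.
  have x2 : (k x).2 = 0 by rewrite -nE -vE vx linear0.
  have /aex[y yE] : a' (k x).1 = 0.
    by apply: (inj_lin0 ii); have := k2 x; rewrite x2 linear0 addr0.
  by exists y; apply: ki; rewrite uE mE yE -x2; case: (k x).
Qed.

(** Dual to [horseshoe]: the middle embedding needs an extension [b] of [a] to [X], which is assumed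
    because [PA] need not be injective. *)
Lemma cohorseshoe A X C PA A' PC C' (i : {linear A -> X}) (p : {linear X -> C})
    (a : {linear A -> PA}) (a' : {linear PA -> A'})
    (c : {linear C -> PC}) (c' : {linear PC -> C'}) (b : {linear X -> PA}) :
  ses i p -> ses a a' -> ses c c' -> (forall x, b (i x) = a x) ->
  exists (X' : lmodType R) (m : {linear X -> (PA * PC)%type}) (q : {linear (PA * PC)%type -> X'})
    (u : {linear A' -> X'}) (v : {linear X' -> C'}), ses m q /\ ses u v.
Proof.
move=> h ha hc bE; have [ii ps ex] := h; have [ai as' aex] := ha; have [ci cs cex] := hc.
have [m mE] : exists m : {linear X -> (PA * PC)%type}, m =1 (fun x => (b x, c (p x))).
  by apply: linear_ex => r x y; rewrite !linearP.
have mi : injective m.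
  apply: lin_inj => x; rewrite mE => -[bx /(inj_lin0 ci)/ex[z zx]].
  by rewrite -zx in bx *; rewrite bE in bx; rewrite (inj_lin0 ai bx) linear0.
have [X' [q hq]] := coker_ses mi; have [_ qs qex] := hq.
have [n nE] : exists n : {linear PA -> (PA * PC)%type}, n =1 (fun x => (x, 0)).
  by apply: linear_ex => r x y; congr pair; rewrite /= scaler0 addr0.
have [|u uE] := @factor_surj _ _ _ _ a' (q \o n) as'.
  move=> x /aex[z <-]; apply/qex; exists (i z).
  by rewrite mE nE bE (ses0 _ h) linear0.
have [t tE] : exists t : {linear (PA * PC)%type -> C'}, t =1 (fun x => c' x.2).
  by apply: linear_ex => r x y; rewrite linearP.
have [|v vE] := @factor_surj _ _ _ _ q t qs.
  by move=> x /qex[z <-]; rewrite tE mE /= (ses0 _ hc).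
exists X', m, q, u, v; split=> //; split.
- apply: lin_inj => y; have [x <-] := as' y; rewrite uE /= => /qex[z].
  rewrite mE nE => -[bz /(inj_lin0 ci)/ex[w wz]].
  by rewrite -bz -wz bE (ses0 _ ha).
- by move=> y; have [x xE] := cs y; exists (q (0, x)); rewrite vE tE.
- move=> y; have [[x1 x2] <-] := qs y; rewrite vE tE /=; split=> [/cex[z zx]|[w]].
    have [x xE] := ps z; exists (a' (x1 - b x)).
    rewrite uE /= nE; apply/eqP; rewrite -subr_eq0 -linearB; apply/eqP/qex; exists (- x).
    rewrite linearN mE xE zx; congr pair; rewrite /= ?sub0r //.
    by rewrite addrAC subrr add0r.
  have [x <-] := as' w; rewrite uE /= nE => /eqP; rewrite -subr_eq0 -linearB => /eqP/qex[z].
  by rewrite mE => -[_] /= /eqP; rewrite sub0r eq_sym eqr_oppLR => /eqP ->; rewrite -linearN (ses0 _ hc).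
Qed.

End SesFacts.

(** * Closure properties of coresolved modules *)

Section Coresolved.
Variables (R : pzRingType) (Phi : forall K A : lmodType R, {linear K -> A} -> Prop).
Arguments Phi {K A}.
Implicit Types A B C K M N P Q X : lmodType R.

Definition acyclic_for M : Prop :=
  forall K A (i : {linear K -> A}) (p : {linear A -> M}), ses i p -> Phi i.

(* a coinductive predicate, encoded as the union of all classes with the closure properties *)
Definition coresolved M : Prop :=
  exists X : lmodType R -> Prop, X M /\ forall N, X N ->
    [/\ acyclic_for N, exists C, linked N C /\ X C & exists K, linked K N /\ X K].

Lemma coresolvedP M : coresolved M ->
  [/\ acyclic_for M, exists C, linked M C /\ coresolved C &
      exists K, linked K M /\ coresolved K].
Proof.
move=> [X [XM XP]]; have [h [C [h1 h2]] [K [h3 h4]]] := XP _ XM.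
by split=> //; [exists C | exists K]; split=> //; exists X.
Qed.

Hypothesis mcPhi : mono_class (@Phi).

(** One projective presentation suffices: any other short exact sequence ending in [M] is a pushout
    of it, by lifting [p] along [p']. *)
Lemma acyclic_for_ses K P M (i : {linear K -> P}) (p : {linear P -> M}) :
  projective_module P -> ses i p -> Phi i -> acyclic_for M.
Proof.
move=> hP h Pi K' A i' p' h'; have [_ ps ex] := h; have [ii' ps' ex'] := h'.
have [b bE] := hP _ _ p' p ps'.
have [|c cE] := @factor_inj _ _ _ _ i' (b \o i) ii'.
  by move=> x; apply/ex'; rewrite /= bE (ses0 _ h).
apply: (mc_pushout mcPhi (i := i) (c := c) (b := b)) => // [a|x k e].
  have [x xE] := ps (p' a); have /ex'[k kE] : p' (a - b x) = 0.
    by rewrite linearB bE xE subrr.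
  by exists x, k; rewrite kE addrC subrK.
have /ex[z zx] : p x = 0 by rewrite -bE e (ses0 _ h').
by exists z => //; apply: ii'; rewrite cE /= zx.
Qed.

Lemma acyclic_for_proj P : projective_module P -> acyclic_for P.
Proof.
move=> hP K A i p h; have [r rE] := ses_split_proj hP h.
by apply: (mc_cancel mcPhi (j := r) (h := idfun)) => //; apply: (mc_id mcPhi).
Qed.

Lemma acyclic_for_retract M X (i : {linear M -> X}) (r : {linear X -> M}) :
  (forall x, r (i x) = x) -> acyclic_for X -> acyclic_for M.
Proof.
move=> ri hX K A k p h; have [Z [u [v [l [hl uv ul ex]]]]] := ses_pullback r h.
have [ki _ _] := h; have [_ _ exl] := hl.
have uv0 z : u z = 0 -> v z = 0 -> z = 0.
  move=> uz /exl[x xz]; rewrite -xz ul in uz.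
  by rewrite -xz (inj_lin0 ki uz) linear0.
have [s sE] : exists s : {linear A -> Z}, forall a, u (s a) = a /\ v (s a) = i (p a).
  apply: (@linear_graph _ _ _ (fun a z => u z = a /\ v z = i (p a))).
  - by move=> a; apply: ex; rewrite ri.
  - move=> a z z' [e1 e2] [e3 e4]; apply/eqP; rewrite -subr_eq0; apply/eqP/uv0.
      by rewrite linearB e1 e3 subrr.
    by rewrite linearB e2 e4 subrr.
  - by move=> c a a' z z' [e1 e2] [e3 e4]; rewrite !linearP e1 e2 e3 e4.
apply: (mc_cancel mcPhi (j := s) (h := l)); last exact: hX hl.
move=> x; apply/eqP; rewrite -subr_eq0; apply/eqP/uv0.
  by rewrite linearB ul; case: (sE (k x)) => ->; rewrite subrr.
rewrite linearB (ses0 _ hl); case: (sE (k x)) => _ ->.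
by rewrite (ses0 _ h) linear0 subrr.
Qed.

Lemma acyclic_for_ext A X C (i : {linear A -> X}) (p : {linear X -> C}) :
  ses i p -> acyclic_for A -> acyclic_for C -> acyclic_for X.
Proof.
move=> h hA hC K Y k q hk.
have [Z [z [l [t [h1 h2 h3 h4]]]]] := ses_kernel_comp hk h.
by apply: (mc_comp mcPhi (i := l) (j := z)) => //; [exact: hA h2 | exact: hC h1].
Qed.

Lemma coresolved_proj P : projective_module P -> coresolved P.
Proof.
move=> hP; exists (@projective_module R); split=> // Q hQ.
have lk : linked Q Q.
  have [i [p [h _ _]]] := ses_pair Q Q.
  by exists (Q * Q)%type, i, p; split=> //; apply: proj_pair.
by split; [exact: acyclic_for_proj | exists Q | exists Q].
Qed.

(** This supplies the extension that [cohorseshoe] requires. For [pext_mono] it is immediate; for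
    [tor_mono] it is the vanishing of [Ext^1] against projectives. *)
Hypothesis coresolved_pext : forall C, coresolved C ->
  forall K A (i : {linear K -> A}) (p : {linear A -> C}), ses i p -> pext_mono i.

(** The class of all extensions of coresolved modules is itself closed: the horseshoe constructions
    present its neighbours on both sides as extensions again. *)
Lemma coresolved_ext A X C (i : {linear A -> X}) (p : {linear X -> C}) :
  ses i p -> coresolved A -> coresolved C -> coresolved X.
Proof.
move=> h hA hC.
exists (fun X => exists A C (i : {linear A -> X}) (p : {linear X -> C}),
  [/\ ses i p, coresolved A & coresolved C]); split; first by exists A, C, i, p.
move=> {A C i p h hA hC} {}X [A [C [i [p [h hA hC]]]]].
have [aA [A1 [[PA [a [a' [hPA ha]]]] hA1]] [A2 [[QA [b [b' [hQA hb]]]] hA2]]] := coresolvedP hA.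
have [aC [C1 [[PC [c [c' [hPC hc]]]] hC1]] [C2 [[QC [d [d' [hQC hd]]]] hC2]]] := coresolvedP hC.
split; first exact: acyclic_for_ext h aA aC.
  have [f fE] := coresolved_pext hC h hPA a.
  have [X' [m [q [u [v [h1 h2]]]]]] := cohorseshoe h ha hc fE.
  exists X'; split; last by exists A1, C1, u, v.
  by exists (PA * PC)%type, m, q; split=> //; apply: proj_pair.
have [_ ps _] := h; have [l lE] := hQC _ _ p d' ps.
have [K [k [k' [u [v [h1 h2]]]]]] := horseshoe h hb hd lE.
exists K; split; last by exists A2, C2, u, v.
by exists (QA * QC)%type, k, k'; split=> //; apply: proj_pair.
Qed.

(** [M] is a retract of [X], hence acyclic. It embeds in [PC] with a cokernel that is an extension
    of [C] by [P], and it is covered by the kernel of [QK] over [P], a direct summand of [QK]. *)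
Lemma coresolved_kernel M X P (i : {linear M -> X}) (p : {linear X -> P}) :
  ses i p -> coresolved X -> projective_module P -> coresolved M.
Proof.
move=> h hX hP.
exists (fun M => coresolved M \/ exists X P (i : {linear M -> X}) (p : {linear X -> P}),
  [/\ ses i p, coresolved X & projective_module P]).
split; first by right; exists X, P, i, p.
move=> {X P i p h hX hP} {}M [/coresolvedP[h [C [h1 h2]] [K [h3 h4]]]|[X [P [i [p [h hX hP]]]]]].
  by split=> //; [exists C | exists K]; split=> //; left.
have [aX [C [[PC [j [q [hPC hj]]]] hC]] [K [[QK [k [l [hQK hk]]]] hK]]] := coresolvedP hX.
split.
- by have [r rE] := ses_split_proj hP h; exact: acyclic_for_retract rE aX.
- have [Y [y [u [v [h1 h2 _]]]]] := ses_coker_comp h hj.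
  exists Y; split; first by exists PC, (j \o i), y.
  by left; apply: coresolved_ext h2 _ hC; exact: coresolved_proj.
- have [Y [y [u [v [h1 h2 _ _]]]]] := ses_kernel_comp hk h.
  exists K; split; last by left.
  exists Y, u, v; split=> //.
  have [r rE] := ses_split_proj hP h1.
  exact: proj_retract rE hQK.
Qed.

End Coresolved.

(** * Coresolved modules and complexes *)

Section Complexes.
Variables (R : pzRingType) (Phi : forall K A : lmodType R, {linear K -> A} -> Prop).
Arguments Phi {K A}.
Implicit Types A B C K M N Q X : lmodType R.
Hypothesis mcPhi : mono_class (@Phi).

Lemma coresolved_family M : coresolved (@Phi) M ->
  exists Z : int -> lmodType R, [/\ Z 0 = M, forall k, acyclic_for (@Phi) (Z k) &
    forall k, linked (Z (k + 1)) (Z k)].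
Proof.
move=> hM; pose T := {N | coresolved (@Phi) N}.
have stepL (N : T) : exists K : T, linked (sval K) (sval N).
  by have [_ _ [K [h hK]]] := coresolvedP (svalP N); exists (exist _ K hK).
have stepR (N : T) : exists C : T, linked (sval N) (sval C).
  by have [_ [C [h hC]] _] := coresolvedP (svalP N); exists (exist _ C hC).
have [l lP] := choice stepL; have [r rP] := choice stepR.
pose L n := iter n l (exist _ M hM : T); pose S n := iter n r (exist _ M hM : T).
(* Nonnegative indices run through syzygies of [M] and negative ones through cosyzygies; [Negz n] is
   [-(n+1)], whence [S n.+1]. *)
exists (fun k => match k with Posz n => sval (L n) | Negz n => sval (S n.+1) end).
split=> //.
  by case=> n; [case: (coresolvedP (svalP (L n))) | case: (coresolvedP (svalP (S n.+1)))].
case=> [n|[|n]].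
- by rewrite -PoszD addn1; exact: lP.
- exact: rP.
- have -> : Negz n.+1 + 1 = Negz n by rewrite !NegzE -addn1 PoszD opprD subrK.
  exact: rP.
Qed.

Section FamilyComplex.
Variables (Z P : int -> lmodType R) (i : forall k, {linear Z (k + 1) -> P k}).
Variables (p : forall k, {linear P k -> Z k}) (ip_ses : forall k, ses (i k) (p k)).

Fact family_diff2 k (x : P (k + 1 + 1)) :
  (i k \o p (k + 1)) ((i (k + 1) \o p (k + 1 + 1)) x) = 0.
Proof. by rewrite /= (ses0 _ (ip_ses (k + 1))) linear0. Qed.

Definition family_complex : complex R :=
  @Complex R P (fun k => i k \o p (k + 1)) family_diff2.

Lemma family_acyclic : acyclic family_complex.
Proof.
move=> k y; split=> [|[x <-]]; last exact: family_diff2.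
have [ii _ _] := ip_ses k; have [_ _ ex] := ip_ses (k + 1).
move=> /= /(inj_lin0 ii)/ex[z <-].
have [_ ps _] := ip_ses (k + 1 + 1); have [x <-] := ps z.
by exists x.
Qed.

Lemma family_syzygy : is_syzygy (Z 0) family_complex.
Proof.
exists (- 2%:Z), (i (- 2%:Z + 1)); have [ii _ ex] := ip_ses (- 2%:Z + 1).
split=> // y; have [ii' _ _] := ip_ses (- 2%:Z).
split=> [/= /(inj_lin0 ii')/ex //|[x <-]].
by rewrite /= (ses0 _ (ip_ses (- 2%:Z + 1))) linear0.
Qed.

End FamilyComplex.

Lemma coresolved_complex M : coresolved (@Phi) M ->
  exists (Z P : int -> lmodType R) (i : forall k, {linear Z (k + 1) -> P k})
    (p : forall k, {linear P k -> Z k}),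
  [/\ Z 0 = M, forall k, projective_module (P k), forall k, ses (i k) (p k) &
      forall k, Phi (i k)].
Proof.
move=> /coresolved_family[Z [Z0 aZ lZ]].
pose P k := projT1 (cid (lZ k)); pose i k := projT1 (cid (projT2 (cid (lZ k)))).
pose p k := projT1 (cid (projT2 (cid (projT2 (cid (lZ k)))))).
have h k : projective_module (P k) /\ ses (i k) (p k).
  exact: (projT2 (cid (projT2 (cid (projT2 (cid (lZ k))))))).
exists Z, P, i, p; split=> // k; try by have [] := h k.
by have [_ hk] := h k; exact: aZ hk.
Qed.

Lemma coresolved_of_complex (X : complex R) M :
  (forall k, projective_module (X k)) -> acyclic X ->
  (forall k N (q : {linear X (k + 1) -> N}) (j : {linear N -> X k}), surj q -> injective j ->
    (forall x, cx_diff X k x = j (q x)) -> Phi j) ->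
  is_syzygy M X -> coresolved (@Phi) M.
Proof.
move=> hX aX XPhi hM; exists (fun M => is_syzygy M X); split=> // {hM} {}M [k [f [fi fE]]].
have [|q qE] := @factor_inj _ _ _ _ f (cx_diff X (k + 1)) fi.
  by move=> x; apply/fE/aX; exists x.
have qs : surj q.
  by move=> m; have /fE/aX[x xE] : image_of f (f m) by [exists m]; exists x; apply: fi; rewrite qE.
have [K [j hj]] := kernel_ses qs; have [ji _ jex] := hj.
have jk : exact_at j (cx_diff X (k + 1)).
  move=> y; rewrite -jex -qE; split=> [/(inj_lin0 fi) //|->]; exact: linear0.
split.
- apply: (acyclic_for_ses mcPhi (hX _) hj).
  have [|t tE] := @factor_inj _ _ _ _ j (cx_diff X (k + 1 + 1)) ji.
    by move=> x; apply/jk/aX; exists x.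
  apply: (XPhi _ _ t) => // m.
  by have /jk/aX[x xE] : image_of j (j m) by [exists m]; exists x; apply: ji; rewrite tE.
- have [k' kE] : exists k', k = k' + 1 by exists (k - 1); rewrite subrK.
  subst k.
  have [C [c [ci cex]]] := kernel_ex (cx_diff X k').
  have [|t tE] := @factor_inj _ _ _ _ c (cx_diff X (k' + 1)) ci.
    by move=> x; apply/cex/aX; exists x.
  exists C; split; last by exists k', c.
  exists (X (k' + 1 + 1)), f, t; split=> //; split=> //.
    by move=> y; have /cex/aX[x xE] : image_of c (c y) by [exists y]; exists x; apply: ci; rewrite tE.
  by move=> y; rewrite -fE -tE; split=> [->|/(inj_lin0 ci) //]; exact: linear0.
- exists K; split; last by exists (k + 1), j.
  by exists (X (k + 1 + 1)), j, q.
Qed.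

End Complexes.

Section Identification.
Variable R : pzRingType.
Implicit Types M : lmodType R.

(** By right exactness, acyclicity of the tensored complex amounts to the inclusions of the syzygies
    staying injective after tensoring. *)
Lemma PGF_coresolved M : PGF M <-> coresolved (@tor_mono R) M.
Proof.
split=> [[X [hX aX tX sX]]|/coresolved_complex[Z [P [i [p [<- hP h iPhi]]]]]].
  apply: (coresolved_of_complex (@tor_mono_class R) hX aX) sX => k N q j qs ji dE E hE w w0.
  have [w' wE] := @tensor_map_surj R E _ _ q qs w.
  have /(tX E hE)[v vE] : tensor_map (cx_diff X k) w' = 0.
    by rewrite (tensor_map_comp w' dE) wE.
  rewrite -wE -vE -(tensor_map_comp v (h := \0)) ?tensor_map_null // => x.
  by apply: ji; rewrite -dE cx_diff2 linear0.
exists (family_complex h); split=> //; [exact: family_acyclic | | exact: family_syzygy].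
move=> E hE k w.
have dE l (u : tensor E (P (l + 1))) : @tensor_map R E _ _ (cx_diff (family_complex h) l) u =
  tensor_map (i l) (tensor_map (p (l + 1)) u) by exact: tensor_map_comp.
have [_ ps ex] := h (k + 1); split=> [|[v <-]].
  rewrite dE => /(iPhi k E hE)/(tensor_right_exact ps ex)[v vE].
  have [_ ps' _] := h (k + 1 + 1).
  by have [u uE] := @tensor_map_surj R E _ _ _ ps' v; exists u; rewrite dE uE.
rewrite -(tensor_map_comp v (h := \0)) ?tensor_map_null // => x.
by rewrite cx_diff2.
Qed.

Lemma Gprojective_coresolved M : Gprojective M <-> coresolved (@pext_mono R) M.
Proof.
split=> [[X [hX aX tX sX]]|/coresolved_complex[Z [P [i [p [<- hP h iPhi]]]]]].
  apply: (coresolved_of_complex (@pext_mono_class R) hX aX) sX => k N q j qs ji dE Q hQ f.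
  have [|g gE] := (tX Q hQ k (f \o q)).1.
    move=> x; have q0 : q (cx_diff X (k + 1) x) = 0.
      by apply: (inj_lin0 ji); rewrite -dE cx_diff2.
    by rewrite /= q0 linear0.
  by exists g => x; have [y <-] := qs x; rewrite -dE gE.
exists (family_complex h); split=> //; [exact: family_acyclic | | exact: family_syzygy].
move=> Q hQ k f; have [_ ps ex] := h (k + 1); split=> [f0|[g gE] x]; last first.
  by rewrite -gE cx_diff2 linear0.
have [|f' f'E] := @factor_surj _ _ _ _ (p (k + 1)) f ps.
  move=> y /ex[z <-]; have [_ ps' _] := h (k + 1 + 1); have [x <-] := ps' z.
  exact: f0.
by have [g gE] := iPhi k Q hQ f'; exists g => x; rewrite -f'E -gE.
Qed.

End Identification.

(** * PGF-modules are Gorenstein projective *)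

Section MainStep.
Variable R : pzRingType.

(** Composing [f] with [p 0] gives a cocycle on [P 0], hence a chain map to a pure coresolution of
    [Q]. A null-homotopy of this chain map restricts in degree zero to a map from [P 1] that extends
    [f]. *)
Lemma tor_mono_pext (M P : nat -> lmodType R) (i : forall j, {linear M j -> P j})
    (p : forall j, {linear P j -> M j.+1}) :
  (forall j, projective_module (P j)) -> (forall j, ses (i j) (p j)) ->
  (forall j, tor_mono (i j)) -> pext_mono (i 1).
Proof.
move=> hP h tm Q hQ f; pose d j : {linear P j -> P j.+1} := i j.+1 \o p j.
have sol j (S : seq (P j)) : exists T : seq (M j), forall y : {linear P j -> R^o},
    (forall t, t \in T -> y (i j t) = 0) ->
    exists w : {linear P j.+1 -> R^o}, forall s, s \in S -> y s = w (d j s).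
  apply: local_solvability_ring => // E hE w.
  rewrite (tensor_map_comp w (f := p j) (g := i j.+1)) // => /(tm j.+1 E hE).
  by have [_ ps ex] := h j; exact: tensor_right_exact.
pose T j S := projT1 (cid (sol j S)).
have TP : locally_solvable i d T R^o by move=> j S; exact: (projT2 (cid (sol j S))).
have solQ := locally_solvable_proj TP hQ.
have [|X [C [pi [iota [g [e [[pi0 pi0s] hi pure_i gE eE]]]]]]] :=
    @pure_coresolution R M P i p hP h d (fun j x => erefl) T Q (f \o p 0) solQ.
  by move=> x; rewrite /= (ses0 _ (h 0)) linear0.
pose Ld j := projT1 (cid (dual_basis_ex (hP j))).
have LdP j : dual_basis (Ld j) := projT2 (cid (dual_basis_ex (hP j))).
have combL j (V : lmodType R) (t : {linear P j -> V}) x : comb (Ld j x) t = t x.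
  have [LE _] := LdP j; rewrite -[in RHS](LE x) linear_sum.
  by apply: eq_bigr => c _; rewrite linearZ.
(* All elements of [P j] serve as generators; the differential of [x] is expanded in a dual basis of
   [P j.+1]. *)
pose L j (x : P j) := Ld j.+1 (d j x).
have combK j (V : lmodType R) (t : P j.+2 -> V) x :
    comb (L j x) (fun y => comb (L j.+1 y) t) = 0.
  have [_ Llin] := LdP j.+2; have [s sE] := linear_ex (Llin V t).
  rewrite (eq_comb (t' := s \o d j.+1)) => [|u _]; last by rewrite /= sE.
  by rewrite combL /= (ses0 _ (h j.+1)) !linear0.
have chain j x : iota j (pi j (g j x)) = comb (L j x) (g j.+1).
  by rewrite /L combL gE.
have [s sE] := homotopy_ex pi0 pi0s hi pure_i combK chain.
(* The homotopy [s] is a mere function on generators; the dual basis of [P 1] makes a linear map of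
   it. *)
have [_ Llin] := LdP 1; have [s' s'E] := linear_ex (Llin _ s).
exists (e \o s') => x; have [_ ps _] := h 0; have [y <-] := ps x.
by rewrite -[RHS]eE sE /= s'E.
Qed.

Lemma tor_coresolved_pext M : coresolved (@tor_mono R) M -> acyclic_for (@pext_mono R) M.
Proof.
move=> /(coresolved_family)[Z [<- aZ lZ]].
(* The reindexing by [2 - j] reverses the family so that [M] sits at [j = 2], the cokernel of [i 1];
   one more syzygy precedes it, as [tor_mono_pext] requires. *)
have lm (j : nat) : linked (Z (2%:Z - j%:Z)) (Z (2%:Z - j.+1%:Z)).
  have -> : 2%:Z - j%:Z = (2%:Z - j.+1%:Z) + 1 by rewrite -[j.+1]addn1 PoszD opprD addrA subrK.
  exact: lZ.
pose P j := projT1 (cid (lm j)); pose i j := projT1 (cid (projT2 (cid (lm j)))).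
pose p j := projT1 (cid (projT2 (cid (projT2 (cid (lm j)))))).
have h j : projective_module (P j) /\ ses (i j) (p j).
  exact: (projT2 (cid (projT2 (cid (projT2 (cid (lm j))))))).
have hP j : projective_module (P j) by have [] := h j.
have hs j : ses (i j) (p j) by have [] := h j.
apply: (acyclic_for_ses (@pext_mono_class R) (hP 1) (hs 1)).
exact: (tor_mono_pext (M := fun j => Z (2%:Z - j%:Z)) hP hs (fun j => aZ _ _ _ _ _ (hs j))).
Qed.

Lemma tor_coresolved_sub M : coresolved (@tor_mono R) M -> coresolved (@pext_mono R) M.
Proof.
move=> hM; exists (coresolved (@tor_mono R)); split=> // N hN.
have [_ hC hK] := coresolvedP hN; split=> //; exact: tor_coresolved_pext.
Qed.

End MainStep.

(** * Dimensions *)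

Section Resolutions.
Variable R : pzRingType.
Implicit Types A B C G H K L M N P Q : lmodType R.
Implicit Type X : lmodType R -> Prop.

Fixpoint res X n M : Prop :=
  if n is m.+1 then
    exists G K (i : {linear K -> G}) (p : {linear G -> M}), [/\ X G, ses i p & res X m K]
  else X M.

Lemma res_mono X X' n M : (forall N, X N -> X' N) -> res X n M -> res X' n M.
Proof.
move=> XX'; elim: n M => [|n IH] M /=; first exact: XX'.
by move=> [G [K [i [p [h1 h2 h3]]]]]; exists G, K, i, p; split; auto.
Qed.

Lemma zero_module_ex : exists Z : lmodType R, forall x : Z, x = 0.
Proof.
have [|Z [i [ii iE]]] := @submodule_ex R R^o (fun x => x = 0).
  by split=> [|x y -> ->|r x ->] //; rewrite ?subrr ?scaler0.
by exists Z => x; apply: ii; rewrite linear0; apply/iE; exists x.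
Qed.

Definition iso_closed X : Prop :=
  forall M N (f : {linear M -> N}), injective f -> surj f -> X M -> X N.

(** A resolution is cut into short exact sequences by taking kernels. Closure under isomorphism
    enters at length zero, where the augmentation is an isomorphism from the resolving module. *)
Lemma has_resolutionP X n M : iso_closed X -> has_resolution X M n <-> res X n M.
Proof.
move=> isoX; split; elim: n M => [|n IH] M.
- move=> [G [d [e [XG G0 es ex _]]]]; apply: (isoX _ _ e) => //; last exact: XG.
  by apply: lin_inj => x /ex[y <-]; rewrite (G0 1%N isT y) linear0.
- move=> [G [d [e [XG G0 es ex exd]]]]; have [K [i hi]] := kernel_ses es.
  have [ii _ iE] := hi; exists (G 0), K, i, e; split=> //; first exact: XG.
  apply: IH; have [|e' eE] := @factor_inj _ _ _ _ i (d 0) ii.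
    by move=> x; apply/iE/ex; exists x.
  exists (fun j => G j.+1), (fun j => d j.+1), e'; split=> [j jn|j jn||y|j].
  + exact: XG.
  + exact: G0.
  + move=> y; have /iE/ex[x xE] : image_of i (i y) by exists y.
    by exists x; apply: ii; rewrite eE.
  + by rewrite -exd -eE; split=> [->|/(inj_lin0 ii)//]; rewrite linear0.
  + exact: exd.
- move=> XM; have [Z Z0] := zero_module_ex.
  exists (fun j => if j is 0 then M else Z), (fun j => \0), idfun; split=> //.
  + by case.
  + by case.
  + by move=> y; exists y.
  + by move=> y; split=> [/= ->|[x <-] //]; exists 0.
  + by move=> j y; split=> // _; exists 0; rewrite (Z0 y).
- move=> [G0 [K [i [p [XG h /IH]]]]] [G [d [e [XGj G_0 es ex exd]]]].
  have [ii ps ipE] := h.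
  pose G' j : lmodType R := if j is l.+1 then G l else G0.
  pose d' j : {linear G' j.+1 -> G' j} :=
    match j return {linear G' j.+1 -> G' j} with 0 => i \o e | l.+1 => d l end.
  exists G', d', p; split=> //.
  + by case=> // j; exact: XGj.
  + by case=> // j; exact: G_0.
  + move=> y; rewrite ipE; split=> [[k <-]|[x <-]]; last by exists (e x).
    by have [x <-] := es k; exists x.
  + case=> [|j]; last exact: exd.
    move=> y /=; split=> [/(inj_lin0 ii)/ex //|[x <-]].
    by have -> : e (d 0 x) = 0 by [apply/ex; exists x]; rewrite linear0.
Qed.

Lemma iso_inverse M N (f : {linear M -> N}) : injective f -> surj f ->
  exists g : {linear N -> M}, (forall x, g (f x) = x) /\ forall y, f (g y) = y.
Proof.
move=> fi fs; have [|g gE] := @factor_inj _ _ _ _ f idfun fi; first exact: fs.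
by exists g; split=> // x; apply: fi; rewrite gE.
Qed.

Lemma iso_closed_proj : iso_closed (@projective_module R).
Proof.
move=> M N f fi fs; have [g [_ gE]] := iso_inverse fi fs; exact: proj_retract gE.
Qed.

Lemma is_syzygy_iso M N (f : {linear M -> N}) (S : complex R) : injective f -> surj f ->
  is_syzygy M S -> is_syzygy N S.
Proof.
move=> fi fs [k [i [ii iE]]]; have [g [gK fK]] := iso_inverse fi fs.
exists k, (i \o g); split; first by apply: inj_comp => //; exact: can_inj fK.
move=> y; rewrite iE; split=> [[x <-]|[x <-]]; last by exists (g x).
by exists (f x); rewrite /= gK.
Qed.

Lemma iso_closed_PGF : iso_closed (@PGF R).
Proof.
by move=> M N f fi fs [S [h1 h2 h3 h4]]; exists S; split=> //; exact: (is_syzygy_iso fi fs h4).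
Qed.

Lemma iso_closed_Gprojective : iso_closed (@Gprojective R).
Proof.
by move=> M N f fi fs [S [h1 h2 h3 h4]]; exists S; split=> //; exact: (is_syzygy_iso fi fs h4).
Qed.

Local Notation proj := (@projective_module R).
Local Notation GP := (coresolved (@pext_mono R)).
Local Notation PG := (coresolved (@tor_mono R)).

Lemma GP_proj P : proj P -> GP P.
Proof. exact/coresolved_proj/pext_mono_class. Qed.

Lemma PG_proj P : proj P -> PG P.
Proof. exact/coresolved_proj/tor_mono_class. Qed.

Lemma GP_ext A B C (i : {linear A -> B}) (p : {linear B -> C}) :
  ses i p -> GP A -> GP C -> GP B.
Proof.
apply: coresolved_ext => [|D /coresolvedP[h _ _]]; [exact: pext_mono_class | exact: h].
Qed.

Lemma PG_ext A B C (i : {linear A -> B}) (p : {linear B -> C}) :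
  ses i p -> PG A -> PG C -> PG B.
Proof.
apply: coresolved_ext => [|D /tor_coresolved_pext h]; [exact: tor_mono_class | exact: h].
Qed.

Lemma res_proj n P : proj P -> res proj n P.
Proof.
move=> hP; elim: n => [|n IH] //=; have [i [p [h _ _]]] := ses_pair P P.
by exists (P * P)%type, P, i, p; split=> //; exact: proj_pair.
Qed.

(** Pulling the sequence back along [f] gives an extension of [K] by [L], which splits; the
    splitting yields the lift. *)
Lemma ext_lift L Q B K (j : {linear L -> Q}) (q : {linear Q -> B}) (f : {linear K -> B}) :
  ses j q -> acyclic_for (@ext_mono R L) K -> exists h : {linear K -> Q}, forall x, q (h x) = f x.
Proof.
move=> h aK; have [Z [u [v [k [hk uv uk _]]]]] := ses_pullback f h.
have [r rE] := aK _ _ k v hk idfun; have [_ vs vex] := hk.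
have [|g gE] := @factor_surj _ _ _ _ v (u \- (u \o (k \o r))) vs.
  by move=> z /vex[x <-]; rewrite /= rE subrr.
exists g => x; have [z <-] := vs x.
by rewrite gE linearB /= uv uk (ses0 _ h) subr0.
Qed.

(** Dimension shifting: a map from [K] to [L] lifts to the projective [Q] by induction, extends to
    [P] because [M] is coresolved, and is then sent back to [L]. *)
Lemma GP_ext_finite_pd n L M : res proj n L -> GP M -> acyclic_for (@ext_mono R L) M.
Proof.
elim: n L M => [|n IH] L M /=.
  by move=> hL /coresolvedP[h _ _] K A i p hs; exact: h hs _ hL.
move=> [Q [L' [j [q [hQ hj hL']]]]] /coresolvedP[aM _ [K [[P [i [p [hP hi]]]] hK]]].
apply: (acyclic_for_ses (@ext_mono_class R L) hP hi) => f.
have [f' f'E] := ext_lift f hj (IH _ _ hL' hK).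
have [g gE] := aM _ _ i p hi _ hQ f'.
by exists (q \o g) => x; rewrite /= gE.
Qed.

(* the hypothesis on [a], [b], [s], [t] says that [N] is a retract of [A] up to maps factoring
   through the projective module [P]; unlike being a retract, this passes to syzygies *)
Lemma finite_pd_res m n N A P (a : {linear N -> A}) (b : {linear A -> N})
    (s : {linear N -> P}) (t : {linear P -> N}) :
  proj P -> (forall x, b (a x) + t (s x) = x) -> res proj n N -> res GP m A -> res proj m N.
Proof.
elim: m n N A P a b s t => [|m IH] n N A P a b s t hP ab hN /=.
  move=> /coresolvedP[_ [C [[P' [j [q [hP' hj]]]] hC]] _].
  (* The map [b] extends to the projective [P'], so [N] is a retract of [P' * P]. *)
  have [g gE] := GP_ext_finite_pd hN hC hj b.
  have [u uE] : exists u : {linear N -> (P' * P)%type}, u =1 (fun x => (j (a x), s x)).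
    by apply: linear_ex => r x y; rewrite !linearP.
  have [v vE] : exists v : {linear (P' * P)%type -> N}, v =1 (fun x => g x.1 + t x.2).
    by apply: linear_ex => r x y; rewrite !linearP scalerDr addrACA.
  by apply: (@proj_retract _ _ _ u v) => [x|]; [rewrite uE vE /= gE | exact: proj_pair].
move=> [H [A' [ia [pa [hH hA hA']]]]].
case: n hN => [|n]; first by move=> hN; exact: (@res_proj m.+1).
move=> [P0 [K [k [p [hP0 hk hK]]]]]; have [ki ps kex] := hk.
have [iai pas paex] := hA.
have [a0 a0E] := hP0 _ _ pa (a \o p) pas.
have [b0 b0E] := ext_lift (b \o pa) hk (GP_ext_finite_pd hK hH).
have [t0 t0E] := hP _ _ p t ps.
(* The lifts [b0], [a0] and [t0] reproduce the identity of [P0] up to an error [th] in [K].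
   Restricted to [K], this is again the retract condition, now through [P0]. *)
have [|th thE] := @factor_inj _ _ _ _ k (idfun \- ((b0 \o a0) \+ (t0 \o (s \o p)))) ki.
  by move=> x; apply/kex; rewrite linearB /= linearD b0E /= a0E /= t0E ab subrr.
have [|a' a'E] := @factor_inj _ _ _ _ ia (a0 \o k) iai.
  by move=> x; apply/paex; rewrite /= a0E /= (ses0 _ hk) linear0.
have [|b' b'E] := @factor_inj _ _ _ _ k (b0 \o ia) ki.
  by move=> x; apply/kex; rewrite /= b0E /= (ses0 _ hA) linear0.
exists P0, K, k, p; split=> //; apply: (IH n _ A' P0 a' b' k th) => // x.
apply: ki; rewrite linearD b'E thE /= a'E /= (ses0 _ hk) !linear0 addr0.
by rewrite addrC subrK.
Qed.

Lemma res_GP_ext m M N G (i : {linear M -> N}) (p : {linear N -> G}) :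
  ses i p -> res GP m M -> GP G -> res GP m N.
Proof.
elim: m M N G i p => [|m IH] M N G i p h /=; first exact: GP_ext h.
move=> [H [M' [j [q [hH hj hM']]]]] /coresolvedP[_ _ [G2 [[P [c [c' [hP hc]]]] hG2]]].
have [_ ps _] := h; have [l lE] := hP _ _ p c' ps.
have [K [k [k' [u [v [h1 h2]]]]]] := horseshoe h hj hc lE.
exists (H * P)%type, K, k, k'; split=> //; last exact: IH h2 hM' hG2.
have [x [y [hxy _ _]]] := ses_pair H P.
by apply: GP_ext hxy hH _; exact: GP_proj.
Qed.

(** Embed the kernel [K] in [N] by induction and push out. The pushout [X] is an extension of [G']
    by [G], so it embeds in a projective [P] with coresolved cokernel. Then [M] embeds in [P] modulo
    [N] with that same cokernel. *)
Lemma res_PG_embed m M : res PG m M ->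
  exists N G (i : {linear M -> N}) (p : {linear N -> G}), [/\ ses i p, res proj m N & PG G].
Proof.
elim: m M => [|m IH] M /=.
  move=> /coresolvedP[_ [C [[P [i [p [hP hi]]]] hC]] _].
  by exists P, C, i, p.
move=> [G [K [i [p [hG hi /IH]]]]] [N [G' [j [q [hj hN hG']]]]].
have [X [u [v [h1 h2 h3]]]] := pushout_ex i j.
have [t ht] := pushout_ses h1 h2 h3 hi.
have [|||w hw] := pushout_ses (i := j) (p := q) (f := i) (u := v) (v := u) _ _ _ hj.
- by move=> x; rewrite h1.
- by move=> b a /esym/h2[x [e1 e2]]; exists x.
- by move=> z; have [a [b ->]] := h3 z; exists b, a; rewrite addrC.
have /coresolvedP[_ [C [[P [c [d [hP hc]]]] hC]] _] := PG_ext hw hG hG'.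
have [Y [y [k [l [h4 h5 _]]]]] := ses_coker_comp ht hc.
by exists Y, C, k, l; split=> //; exists P, N, (c \o v), y.
Qed.

(** The pullback of [P] and a projective cover [Q] of [G] is an extension of [P] by [K], hence
    coresolved; it also maps onto [Q] with kernel [M]. *)
Lemma PG_kernel M P G (i : {linear M -> P}) (p : {linear P -> G}) :
  ses i p -> proj P -> PG G -> PG M.
Proof.
move=> h hP /coresolvedP[_ _ [K [[Q [j [q [hQ hj]]]] hK]]].
have [Z [u [v [h1 h2 h3]]]] := pullback_ex p q.
have [k [hk _]] := pullback_ses h1 h2 h3 h.
have [|||l [hl _]] := pullback_ses (p := q) (f := p) (u := v) (v := u) _ _ _ hj.
- by move=> z; rewrite h1.
- by move=> a b /esym/h2[z [e1 e2]]; exists z.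
- by move=> z e1 e2; exact: h3.
apply: (coresolved_kernel (@tor_mono_class R)) hk _ hQ; last first.
  by apply: PG_ext hl hK _; exact: PG_proj.
by move=> D /tor_coresolved_pext.
Qed.

(** Only the first term of the resolution of [N] changes: [P] is replaced by the kernel of its map
    onto [G], which covers [M] with the same kernel [K]. *)
Lemma res_PG_kernel m M N G (i : {linear M -> N}) (p : {linear N -> G}) :
  ses i p -> res proj m N -> PG G -> res PG m M.
Proof.
case: m => [|m] h; first exact: PG_kernel h.
move=> [P [K [k [q [hP hk hK]]]]] hG.
have [Y [y [l [t [h1 h2 _ _]]]]] := ses_kernel_comp hk h.
exists Y, K, l, t; split=> //; first exact: PG_kernel h1 hP hG.
by apply: res_mono hK => Q; exact: PG_proj.
Qed.

Lemma res_projP n M : has_resolution proj M n <-> res proj n M.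
Proof. exact/has_resolutionP/iso_closed_proj. Qed.

Lemma res_PGFP n M : has_resolution (@PGF R) M n <-> res PG n M.
Proof.
rewrite (has_resolutionP _ _ iso_closed_PGF).
by split; apply: res_mono => N /PGF_coresolved.
Qed.

Lemma res_GprojectiveP n M : has_resolution (@Gprojective R) M n <-> res GP n M.
Proof.
rewrite (has_resolutionP _ _ iso_closed_Gprojective).
by split; apply: res_mono => N /Gprojective_coresolved.
Qed.

Lemma finite_pd_res_GP m n M : res proj n M -> res GP m M -> res proj m M.
Proof.
move=> hn hm; have [P [p [hP _]]] := enough_proj M.
apply: (@finite_pd_res m n M M P idfun idfun \0 p) => // x.
by rewrite /= linear0 addr0.
Qed.

Lemma resdim_eq X X' M n : resdim X M = Some n ->
  has_resolution X' M n -> (forall m, has_resolution X' M m -> has_resolution X M m) ->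
  resdim X' M = Some n.
Proof.
move=> /resdim_Some[_ nmin] h h'; apply/resdim_Some; split=> // m /h'; exact: nmin.
Qed.

End Resolutions.

Theorem corollary3p7 (R : pzRingType) (M : lmodType R) :
  (pd M <> None -> PGFdim M = pd M) /\
  (PGFdim M <> None -> Gpd M = PGFdim M).
Proof.
split.
- rewrite /PGFdim; case pdE: (pd M) => [n|] // _.
  have [/res_projP hn _] := (resdim_Some _ _ _).1 pdE.
  apply: (resdim_eq pdE) => [|m /res_PGFP hm].
    by apply/res_PGFP; apply: res_mono hn => N; exact: PG_proj.
  apply/res_projP; apply: finite_pd_res_GP hn _.
  by apply: res_mono hm => N; exact: tor_coresolved_sub.
- rewrite /Gpd; case dE: (PGFdim M) => [n|] // _.
  have [/res_PGFP hn _] := (resdim_Some _ _ _).1 dE.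
  apply: (resdim_eq dE) => [|m /res_GprojectiveP hm].
    by apply/res_GprojectiveP; apply: res_mono hn => N; exact: tor_coresolved_sub.
  (* [N] has finite projective dimension and, as an extension of [G] by [M], a Gorenstein projective
     resolution of length [m]. So it has a projective resolution of length [m], which gives [M] a
     PGF-resolution of that length. *)
  have [N [G [i [p [h hN hG]]]]] := res_PG_embed hn.
  apply/res_PGFP; apply: (res_PG_kernel h) => //; apply: (finite_pd_res_GP hN).
  by apply: (res_GP_ext h hm); exact: tor_coresolved_sub.
Qed.
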